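(* For all integers $d,n\geq 2$, the lattice $\mathcal{NC}_{G(d,d,n)}$ of $G(d,d,n)$-noncrossing partitions admits a symmetric Boolean decomposition. Consequently, it admits a symmetric chain decomposition, it is strongly Sperner, and the sequence of its rank numbers is symmetric, unimodal, and $\gamma$-nonnegative.
   Context: $G(d,d,n)$ is the complex reflection group of $n\times n$ monomial matrices whose nonzero entries are $d$-th roots of unity and whose product of nonzero entries is $1$. For a well-generated complex reflection group $W$ with set of reflections $T$, the absolute length $\ell_T(w)$ is the minimal number of reflections whose product is $w$, and the absolute order is $u\leq_T v$ iff $\ell_T(v)=\ell_T(u)+\ell_T(u^{-1}v)$. For a Coxeter element $\gamma$ of $W$ (a $\zeta$-regular element of order $h$, $h$ the largest degree of $W$), $\mathcal{NC}_W$ is the interval $[\varepsilon,\gamma]$ in $(W,\leq_T)$; it is a graded lattice (rank function $\ell_T$) whose isomorphism type does not depend on the choice of $\gamma$. A decomposition of a poset $P$ is a partition of $P$ into parts $D$ such that each $(D,\leq)$ is connected (not a disjoint union of two or more nonempty subposets) and every cover relation of $(D,\leq)$ is a cover relation of $P$. A decomposition of a graded poset of rank $N$ is symmetric if for each part there is a bijection from its minimal to its maximal elements such that corresponding $p,q$ satisfy $\mathrm{rk}(p)+\mathrm{rk}(q)=N$. A symmetric chain (resp. Boolean) decomposition is a symmetric decomposition whose parts are chains (resp. Boolean lattices). A $k$-family is a subset containing no chain with $k+1$ elements; the poset is $k$-Sperner if the maximum size of a $k$-family equals the sum of the $k$ largest rank numbers, and strongly Sperner if it is $k$-Sperner for all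 $k\in[N]$. If the rank-generating polynomial $\sum_k r_k t^k$ is symmetric it can be written $\sum_{j=0}^{\lfloor N/2\rfloor}\gamma_j t^j(1+t)^{N-2j}$; it is $\gamma$-nonnegative if all $\gamma_j\geq 0$. *)

(* Defs.v *)
From HB Require Import structures.
From mathcomp Require Import all_boot all_order all_algebra all_field.
From Stdlib Require Import ClassicalEpsilon.
Set Implicit Arguments. Unset Strict Implicit. Unset Printing Implicit Defensive.
Import Order.TTheory GRing.Theory Num.Theory.
Local Open Scope ring_scope.

(* The complex reflection group G(d,d,n), as n x n complex matrices    *)
(* (complex numbers modelled by the algebraic closure algC of Q, which *)
(* contains all roots of unity and all eigenvalues of these matrices). *)

Definition in_W (d n : nat) (A : 'M[algC]_n) : bool :=
  [&& [forall i, #|[pred j | A i j != 0]| == 1%N],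
      [forall j, #|[pred i | A i j != 0]| == 1%N],
      [forall i, forall j, (A i j != 0) ==> (A i j ^+ d == 1)] &
      (\prod_(i < n) \prod_(j < n | A i j != 0) A i j == 1)].

Definition is_reflection (d n : nat) (r : 'M[algC]_n) : bool :=
  in_W d r && (\rank (r - 1%:M) == 1%N).

Definition mprod (n : nat) (s : seq 'M[algC]_n) : 'M[algC]_n :=
  foldr (fun a b => a *m b) 1%:M s.

Definition refl_word_len (d n : nat) (w : 'M[algC]_n) (k : nat) : Prop :=
  (exists s, [/\ all (@is_reflection d n) s, size s = k & mprod s = w]) /\
  (forall s, all (@is_reflection d n) s -> mprod s = w -> (k <= size s)%N).

Definition abs_length (d n : nat) (w : 'M[algC]_n) : nat :=
  epsilon (inhabits 0%N) (refl_word_len d w).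

Definition abs_le (d n : nat) (u v : 'M[algC]_n) : bool :=
  abs_length d v == (abs_length d u + abs_length d (invmx u *m v))%N.

(* degrees of G(d,d,n): d, 2d, ..., (n-1)d and n (Shephard-Todd) *)
Definition degrees (d n : nat) : seq nat :=
  rcons [seq (k * d)%N | k <- iota 1 (n - 1)] n.

Definition coxeter_number (d n : nat) : nat := \max_(e <- degrees d n) e.

(* zeta = exp(2 pi i / h): h.-root (-1) is exp(i pi / h) *)
Definition zeta_of (h : nat) : algC := (h.-root (-1)) ^+ 2.

Definition mpow (n : nat) (g : 'M[algC]_n) (k : nat) : 'M[algC]_n :=
  iter k (fun a => g *m a) 1%:M.

Definition has_order (n : nat) (g : 'M[algC]_n) (h : nat) : Prop :=
  (0 < h)%N /\ mpow g h = 1%:M /\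
  (forall k, (0 < k < h)%N -> mpow g k != 1%:M).

Definition is_regular (d n : nat) (g : 'M[algC]_n) (z : algC) : Prop :=
  exists v : 'cV[algC]_n,
    g *m v = z *: v /\ (forall r, is_reflection d r -> r *m v != v).

Definition is_coxeter (d n : nat) (g : 'M[algC]_n) : Prop :=
  in_W d g /\ has_order g (coxeter_number d n) /\
  is_regular d g (zeta_of (coxeter_number d n)).

Definition in_NC (d n : nat) (g x : 'M[algC]_n) : bool :=
  [&& in_W d x, abs_le d 1%:M x & abs_le d x g].

(* the poset NC, carried by the finite type of elements of an          *)
(* enumeration s of the interval                                       *)
Definition NC_le (d n : nat) (s : seq 'M[algC]_n) : rel (seq_sub s) :=
  fun x y => abs_le d (val x) (val y).

Definition NC_rk (d n : nat) (s : seq 'M[algC]_n) : seq_sub s -> nat :=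
  fun x => abs_length d (val x).

Section Poset.
Variables (T : finType) (le : rel T) (rk : T -> nat) (N : nat).

Definition plt (x y : T) : bool := (x != y) && le x y.

Definition covers_in (D : {set T}) (x y : T) : bool :=
  [&& x \in D, y \in D, plt x y & [forall z in D, ~~ (plt x z && plt z y)]].

Definition poset_connected (D : {set T}) : Prop :=
  forall A : {set T}, A \subset D -> A != set0 -> A != D ->
    exists x y, [/\ x \in A, y \in D :\: A & le x y || le y x].

Definition is_decomposition (P : {set {set T}}) : Prop :=
  partition P [set: T] /\
  forall D, D \in P ->
    poset_connected D /\
    (forall x y, covers_in D x y -> covers_in [set: T] x y).

Definition minimals (D : {set T}) : {set T} :=
  [set x in D | [forall y in D, le y x ==> (y == x)]].
Definition maximals (D : {set T}) : {set T} :=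
  [set x in D | [forall y in D, le x y ==> (y == x)]].

Definition symmetric_part (D : {set T}) : Prop :=
  exists f : T -> T,
    [/\ {in minimals D &, injective f}, f @: minimals D = maximals D &
        {in minimals D, forall p, (rk p + rk (f p))%N = N}].

Definition is_chain (D : {set T}) : Prop :=
  {in D &, forall x y, le x y || le y x}.

Definition is_boolean (D : {set T}) : Prop :=
  exists k, exists phi : {set 'I_k} -> T,
    [/\ injective phi, phi @: [set: {set 'I_k}] = D &
        forall A B, le (phi A) (phi B) = (A \subset B)].

Definition has_SBD : Prop :=
  exists P, is_decomposition P /\
    forall D, D \in P -> is_boolean D /\ symmetric_part D.

Definition has_SCD : Prop :=
  exists P, is_decomposition P /\
    forall D, D \in P -> is_chain D /\ symmetric_part D.

Definition rank_number (j : nat) : nat := #|[set x | rk x == j]|.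

Definition k_family (k : nat) (F : {set T}) : Prop :=
  forall C : {set T}, C \subset F -> is_chain C -> (#|C| <= k)%N.

Definition sum_largest_ranks (k : nat) : nat :=
  \sum_(r <- take k (sort geq [seq rank_number j | j <- iota 0 N.+1])) r.

Definition k_sperner (k : nat) : Prop :=
  (exists F, k_family k F /\ #|F| = sum_largest_ranks k) /\
  (forall F, k_family k F -> (#|F| <= sum_largest_ranks k)%N).

Definition strongly_sperner : Prop :=
  forall k, (1 <= k <= N)%N -> k_sperner k.

Definition rank_symmetric : Prop :=
  forall j, (j <= N)%N -> rank_number j = rank_number (N - j).

Definition rank_unimodal : Prop :=
  exists m, (forall i j, (i <= j <= m)%N -> (rank_number i <= rank_number j)%N) /\
            (forall i j, (m <= i <= j)%N -> (j <= N)%N ->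
                         (rank_number j <= rank_number i)%N).

Definition gamma_nonnegative : Prop :=
  exists g : nat -> nat,
    \sum_(j < N.+1) ('X^j *+ rank_number j : {poly int}) =
    \sum_(j < N./2.+1) (('X^j * (1 + 'X) ^+ (N - 2 * j)) *+ g j).

End Poset.

(* Main.v *)
(* Write [nu] for the line that a Coxeter element [g] maps to itself, turned by [- a].
   For [w <= g] and a line [p <> nu] moved by [w], sort the interval [[1, w]] by the value
   [x p]. With [u] the reflection taking [p] to [w p], the fibers over [p] and [w p] are
   [[1, w u]] and [[1, w u] u], together a product with a two-element chain. A nonempty
   fiber over [r] on a third line is [[1, w t u] t] with [t] the reflection taking [p] to
   [r]; its rank is two less and it sits one rank up. All these pieces are centred, so
   they inherit symmetric Boolean decompositions by induction on the length of [w].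
   Up to two fibers are left over, both translates of one smaller interval and off
   centre; with two further translates of it inside the fiber over [nu] they regroup
   into two centred products with a two-element chain. If no such [p] exists then [w]
   is trivial or diagonal.
   All length computations follow from one fact: multiplying an element that fixes [p]
   by a reflection that moves [p] increases the length by one. *)
Require Import Defs.
From HB Require Import structures.
From mathcomp Require Import all_boot all_order all_fingroup all_algebra all_field.
From mathcomp Require Import zify ring.
From Stdlib Require ClassicalEpsilon.
Set Implicit Arguments. Unset Strict Implicit. Unset Printing Implicit Defensive.

(** * Symmetric decompositions *)

(** In [G(d,d,n)] the absolute length can exceed the codimension of the fixed space, so lengths are
    computed on words, by Hurwitz moves, and not by linear algebra. What makes the intervals below
    [g] manageable is a rigidity: a line other than [nu] can be turned only by the one value [a],
    and then [nu] is turned by [- a]. Of the fibers over turned copies of [p] and [w p], only those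
    over [shift a p] and [shift (- a) (w p)] can therefore be nonempty. Centring is arithmetic of
    ranks. Translation by a reflection that raises every length by one suits a piece of rank
    [len w - 2]; a product with a two-element chain suits rank [len w - 1]. In the exceptional case
    the common interval has rank [len w - 3]; its four copies start at ranks 1, 1, 2 and 2, so each
    copy starting at 1 becomes the lower half of a product whose upper half starts at 2. *)

Section Tilings.
Variable T : finType.
Implicit Types (K : {set T} -> Prop) (X Y D : {set T}).

(** The parts stay anonymous: closure under disjoint unions and images is then a plain induction,
    and an actual [partition] is extracted only at the end. *)
Inductive tiled K : {set T} -> Prop :=
| tiled0 : tiled K set0
| tiledU D X : K D -> tiled K X -> [disjoint D & X] -> tiled K (D :|: X).

Lemma tiled1 K D : K D -> tiled K D.
Proof.
move=> KD; rewrite -[D]setU0; apply: tiledU => //; first exact: tiled0.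
by rewrite -setI_eq0 setI0.
Qed.

Lemma tiled_union K X Y : tiled K X -> tiled K Y -> [disjoint X & Y] -> tiled K (X :|: Y).
Proof.
move=> tX tY; elim: tX => [|D X' KD _ IH dDX] dXY; first by rewrite set0U.
move: dXY; rewrite -setI_eq0 setIUl setU_eq0 !setI_eq0 => /andP[dD dX].
rewrite -setUA; apply: tiledU => //; first exact: IH.
by rewrite -setI_eq0 setIUr setU_eq0 !setI_eq0 dDX.
Qed.

Lemma tiled_fibers K (R : finType) (f : T -> R) X (S : {set R}) :
  {in S, forall r, tiled K [set x in X | f x == r]} -> tiled K [set x in X | f x \in S].
Proof.
move=> h; have {h} : {in enum S, forall r, tiled K [set x in X | f x == r]}.
  by move=> r; rewrite mem_enum; apply: h.
have -> : [set x in X | f x \in S] = [set x in X | f x \in enum S].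
  by apply/setP=> x; rewrite !inE mem_enum.
elim: (enum S) => [|r s IH] h.
  by rewrite (_ : [set x in X | _] = set0); [apply: tiled0|apply/setP=> x; rewrite !inE andbF].
have {}IH : tiled K [set x in X | f x \in s].
  by apply: IH => r' r's; apply: h; rewrite inE r's orbT.
have [rs|rs] := boolP (r \in s).
  rewrite (_ : [set x in X | f x \in r :: s] = [set x in X | f x \in s]) //.
  by apply/setP=> x; rewrite !inE; case: eqP => // ->; rewrite rs.
have -> : [set x in X | f x \in r :: s] =
          [set x in X | f x == r] :|: [set x in X | f x \in s].
  by apply/setP=> x; rewrite !inE -andb_orr.
apply: tiled_union => //; first by apply: h; rewrite inE eqxx.
rewrite -setI_eq0; apply/eqP/setP=> x; rewrite !inE.
by case: eqP => [->|]; rewrite ?(negPf rs) !andbF.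
Qed.

End Tilings.

(** Substitution of a set for each point: it covers images ([F x] a singleton), products with a
    two-element chain ([F x] a pair) and the growth of [powerset] by one element. *)
Lemma tiled_bind (T1 T2 : finType) (K1 : {set T1} -> Prop) (K2 : {set T2} -> Prop)
    (F : T1 -> {set T2}) (X : {set T1}) : tiled K1 X ->
  {in X &, forall x y, x != y -> [disjoint F x & F y]} ->
  (forall D : {set T1}, D \subset X -> K1 D -> tiled K2 (\bigcup_(x in D) F x)) ->
  tiled K2 (\bigcup_(x in X) F x).
Proof.
elim=> [|D Y KD _ IH dDY] dF h; first by rewrite big_set0; apply: tiled0.
rewrite bigcup_setU; apply: tiled_union.
- by apply: h => //; apply: subsetUl.
- apply: IH => [x y xY yY|D' D'Y]; first by apply: dF; rewrite inE ?xY ?yY orbT.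
  by apply: h; apply: subset_trans D'Y (subsetUr _ _).
rewrite -setI_eq0; apply/eqP/setP=> z; rewrite !inE.
apply/negbTE/negP=> /andP[/bigcupP[x xD zx] /bigcupP[y yY zy]].
have xy : x != y by apply: contraTneq yY => <-; rewrite (disjointFr dDY).
have /pred0P/(_ z) : [disjoint F x & F y] by apply: dF; rewrite // inE ?xD ?yY ?orbT.
by rewrite /= zx zy.
Qed.

(** * Centred Boolean lattices and chains, their products and translates *)

Section SymmetricParts.
Variables (T : finType) (le : rel T) (rk : T -> nat).
Implicit Types (N : nat) (X D : {set T}).

(** The exact rank [a + #|A|] makes covers of the part raise the rank by one; the last equation says
    that the ranks of bottom and top add up to [N]. Any [finType] may index the atoms, so that
    [option J] adds one. *)
Definition sym_boolean N D := exists (J : finType) (f : {set J} -> T) (a : nat),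
  [/\ f @: setT = D, forall A B, le (f A) (f B) = (A \subset B),
      forall A, rk (f A) = (a + #|A|)%N & (a + a + #|J|)%N = N].

Definition sym_chain N D := exists (m : nat) (h : nat -> T) (a : nat),
  [/\ [set h (val i) | i : 'I_m.+1] = D,
      forall i j, (i <= m)%N -> (j <= m)%N -> le (h i) (h j) = (i <= j)%N,
      forall i, (i <= m)%N -> rk (h i) = (a + i)%N & (a + a + m)%N = N].

(** The three hypotheses on [le] say that [D :|: f @: D] is the product of [D] with a two-element
    chain; the new atom [None] marks the upper copy. *)
Lemma sym_boolean_double N (f : T -> T) D :
  {in D &, forall x y, le (f x) (f y) = le x y} ->
  {in D &, forall x y, le x (f y) = le x y} ->
  {in D &, forall x y, ~~ le (f x) y} ->
  {in D, forall x, rk (f x) = (rk x).+1} ->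
  sym_boolean N D -> sym_boolean N.+1 (D :|: f @: D).
Proof.
move=> hff hxf hfx hrk [J [g [a [gD gle grk Na]]]].
have gD' A : g A \in D by rewrite -gD imset_f.
pose r (A : {set option J}) := Some @^-1: A.
have rI (A : {set J}) : r (Some @: A) = A.
  by apply/setP=> j; rewrite inE mem_imset //; apply: Some_inj.
have rN (A : {set J}) : r (None |: Some @: A) = A.
  by apply/setP=> j; rewrite !inE mem_imset //; apply: Some_inj.
have nN (A : {set J}) : (None \in Some @: A) = false by apply/imsetP=> [[]].
exists (option J), (fun A : {set option J} => if None \in A then f (g (r A)) else g (r A)), a; split.
- apply/setP=> x; rewrite inE; apply/imsetP/orP.
    case=> A _ ->; case: ifP => _; [right|left] => //; exact: imset_f.
  case; first by rewrite -gD => /imsetP[A _ ->]; exists (Some @: A); rewrite // nN rI.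
  case/imsetP=> y; rewrite -gD => /imsetP[A _ ->] ->.
  by exists (None |: Some @: A); rewrite // setU11 rN.
- move=> A B.
  have AB : (A \subset B) =
     ((None \in A) ==> (None \in B)) && (r A \subset r B).
    apply/subsetP/andP=> [s|[/implyP s /subsetP t] [j|]]; last exact: s.
      split; first exact/implyP/s.
      by apply/subsetP=> j; rewrite !inE; apply: s.
    by move=> jA; have := t j; rewrite !inE; apply.
  rewrite AB; case: ifP => NA; case: ifP => NB //=.
  + by rewrite hff.
  + by apply: negbTE; apply: hfx.
  + by rewrite hxf.
- move=> A; have -> : #|A| = ((None \in A) + #|r A|)%N.
    rewrite (cardsD1 None A) -(card_imset (mem (r A)) Some_inj); congr (_ + _)%N.
    apply: eq_card => -[j|]; first by rewrite !inE /= mem_imset ?inE //; apply: Some_inj.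
    by rewrite !inE /= nN.
  by case: ifP => NA; rewrite ?hrk ?gD' // grk; lia.
by rewrite card_option; lia.
Qed.

Lemma tiled_double N (f : T -> T) X :
  reflexive le -> {in X &, injective f} ->
  {in X &, forall x y, le (f x) (f y) = le x y} ->
  {in X &, forall x y, le x (f y) = le x y} ->
  {in X &, forall x y, ~~ le (f x) y} ->
  {in X, forall x, rk (f x) = (rk x).+1} ->
  tiled (sym_boolean N) X -> tiled (sym_boolean N.+1) (X :|: f @: X).
Proof.
move=> le_refl fI hff hxf hfx hrk tX.
have e D : D :|: f @: D = \bigcup_(x in D) [set x; f x].
  apply/setP=> z; rewrite inE; apply/orP/bigcupP.
    by case=> [zD|/imsetP[x xD ->]]; [exists z|exists x]; rewrite // !inE eqxx ?orbT.
  case=> x xD; rewrite !inE => /orP[/eqP->|/eqP->]; [by left|by right; apply: imset_f].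
have nf x y : x \in X -> y \in X -> f x != y.
  by move=> xX yX; apply: contraNneq (hfx x y xX yX) => ->.
rewrite e; apply: tiled_bind tX _ _ => [x y xX yX xy|D DX KD].
  rewrite -setI_eq0; apply/eqP/setP=> z; rewrite !inE.
  apply/negbTE/negP=> /andP[/orP[]/eqP-> /orP[]/eqP h].
  - by rewrite h eqxx in xy.
  - by have := nf y x yX xX; rewrite h eqxx.
  - by have := nf x y xX yX; rewrite h eqxx.
  - by rewrite (fI _ _ xX yX h) eqxx in xy.
have sD x : x \in D -> x \in X by move/subsetP: DX; apply.
rewrite -e; apply/tiled1/sym_boolean_double => //.
- by move=> x y /sD ? /sD; apply: hff.
- by move=> x y /sD ? /sD; apply: hxf.
- by move=> x y /sD ? /sD; apply: hfx.
- by move=> x /sD; apply: hrk.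
Qed.

End SymmetricParts.

Section SymmetricPartsMap.
Variables (T1 T2 : finType) (le1 : rel T1) (le2 : rel T2).
Variables (rk1 : T1 -> nat) (rk2 : T2 -> nat).
Variables (N c : nat) (f : T1 -> T2) (X : {set T1}).
Hypothesis f_inj : {in X &, injective f}.
Hypothesis f_le : {in X &, forall x y, le2 (f x) (f y) = le1 x y}.
Hypothesis f_rk : {in X, forall x, rk2 (f x) = (rk1 x + c)%N}.

Lemma tiled_map (K1 : {set T1} -> Prop) (K2 : {set T2} -> Prop) :
  (forall D : {set T1}, D \subset X -> K1 D -> K2 (f @: D)) -> tiled K1 X -> tiled K2 (f @: X).
Proof.
move=> h tX; have e D : f @: D = \bigcup_(x in D) [set f x].
  apply/setP=> z; apply/imsetP/bigcupP=> -[x xD]; first by move->; exists x; rewrite // inE.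
  by rewrite inE => /eqP->; exists x.
rewrite e; apply: tiled_bind tX _ _ => [x y xX yX xy|D DX KD].
  rewrite disjoints1 inE; apply: contra_neqN xy => /eqP h'; exact: f_inj.
by rewrite -e; apply/tiled1/h.
Qed.

Lemma tiled_boolean_map :
  tiled (sym_boolean le1 rk1 N) X -> tiled (sym_boolean le2 rk2 (N + c + c)) (f @: X).
Proof.
apply: tiled_map => D /subsetP DX [J [g [a [gD gle grk Na]]]].
have gX A : g A \in X by rewrite DX // -gD imset_f.
exists J, (f \o g), (a + c)%N; split.
- by rewrite imset_comp gD.
- by move=> A B /=; rewrite f_le.
- by move=> A /=; rewrite f_rk // grk; lia.
- by lia.
Qed.

Lemma tiled_chain_map :
  tiled (sym_chain le1 rk1 N) X -> tiled (sym_chain le2 rk2 (N + c + c)) (f @: X).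
Proof.
apply: tiled_map => D /subsetP DX [m [h [a [hD hle hrk Na]]]].
have hX i : i <= m -> h i \in X.
  by move=> im; rewrite DX // -hD; apply/imsetP; exists (inord i); rewrite //= inordK.
exists m, (f \o h), (a + c)%N; split.
- by rewrite -hD -imset_comp.
- by move=> i j im jm /=; rewrite f_le ?hX // hle.
- by move=> i im /=; rewrite f_rk ?hX // hrk //; lia.
- by lia.
Qed.

End SymmetricPartsMap.

Lemma tiled_refine (T : finType) (K1 K2 : {set T} -> Prop) X :
  (forall D, K1 D -> tiled K2 D) -> tiled K1 X -> tiled K2 X.
Proof.
move=> h; elim=> [|D Y KD _ IH dDY]; first exact: tiled0.
by apply: tiled_union => //; apply: h.
Qed.

Lemma tiled_partition (T : finType) (K : {set T} -> Prop) X :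
  (forall D, K D -> D != set0) -> tiled K X ->
  exists P, partition P X /\ forall D, D \in P -> K D.
Proof.
move=> h; elim=> [|D Y KD _ [P [PY KP]] dDY].
  exists set0; split=> [|D]; last by rewrite inE.
  by apply/and3P; split; rewrite ?inE ?/cover ?big_set0 //; apply/trivIsetP=> A B; rewrite inE.
exists (D |: P); split; first by apply: partitionU1 => //; apply: h.
by move=> E; rewrite inE => /orP[/set1P->|/KP].
Qed.

(** The construction of de Bruijn, Tengbergen and Kruyswijk: a chain [h 0, ..., h m] avoiding [x]
    yields its extension by [x |: h m] and the chain [x |: h 0, ..., x |: h (m - 1)]. Working with
    subsets of [S] in a fixed type lets the induction delete [x]. *)
Lemma boolean_lattice_chains (J : finType) (S : {set J}) :
  tiled (sym_chain (fun A B : {set J} => A \subset B) (fun A => #|A|) #|S|) (powerset S).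
Proof.
elim: {S}#|S| {-2}S (eqxx #|S|) => [|k IH] S.
  rewrite cards_eq0 => /eqP->; rewrite powerset0; apply: tiled1.
  exists 0, (fun _ => set0), 0; split=> [|i j|i|].
  - apply/setP=> A; rewrite inE; apply/imsetP/eqP=> [[_ _ ->]//|->].
    by exists ord0.
  - by case: i j => [|i] [|j]; rewrite /= ?sub0set.
  - by rewrite leqn0 => /eqP->; rewrite /= cards0.
  - by rewrite cards0.
move=> cS; have [x xS] : exists x, x \in S by apply/set0Pn; rewrite -card_gt0 (eqP cS).
have cS' : #|S :\ x| = k by move: cS; rewrite (cardsD1 x) xS add1n eqSS => /eqP.
have := IH (S :\ x); rewrite cS' eqxx => /(_ isT) tS'.
have -> : powerset S = \bigcup_(A in powerset (S :\ x)) [set A; x |: A].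
  apply/setP=> B; rewrite inE; apply/idP/bigcupP=> [BS|[A]].
    exists (B :\ x); first by rewrite inE setSD.
    rewrite !inE; have [xB|xB] := boolP (x \in B); first by rewrite setD1K ?eqxx ?orbT.
    by rewrite (setDidPl _) ?eqxx // disjoint_sym disjoints1.
  rewrite inE subsetD1 => /andP[AS _]; rewrite !inE => /orP[]/eqP-> //.
  by rewrite subUset sub1set xS.
rewrite (eqP cS); apply: tiled_bind tS' _ _ => [A B|D DS [m [h [a [hD hle hrk Na]]]]].
  rewrite !inE !subsetD1 => /andP[_ xA] /andP[_ xB] AB.
  rewrite -setI_eq0; apply/eqP/setP=> E; rewrite !inE.
  apply/negbTE/negP=> /andP[/orP[]/eqP-> /orP[]/eqP e].
  - by rewrite e eqxx in AB.
  - by move: xA; rewrite e setU11.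
  - by move: xB; rewrite -e setU11.
  - by move: AB; rewrite -(setU1K xA) e setU1K ?eqxx.
have {}hle i j : i <= m -> j <= m -> (h i \subset h j) = (i <= j) by apply: hle.
have {}hrk i : i <= m -> #|h i| = a + i by apply: hrk.
have hS i : i <= m -> h i \subset S /\ x \notin h i.
  move=> im; apply/andP; rewrite -subsetD1 -powersetE (subsetP DS) // -hD.
  by apply/imsetP; exists (inord i); rewrite //= inordK.
have sub1 i : i <= m -> (x |: h i \subset x |: h m) by move=> im; apply: setUS; rewrite hle.
pose h1 i := if i <= m then h i else x |: h m.
pose C1 := [set h1 (val i) | i : 'I_m.+2].
have KC1 : sym_chain (fun A B : {set J} => A \subset B) (fun A => #|A|) k.+1 C1.
  exists m.+1, h1, a; split=> [//|i j im jm|i im|] /=; last by lia.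
    rewrite /h1; case: (leqP i m) => im'; case: (leqP j m) => jm'.
    - exact: hle.
    - have -> : (i <= j) by lia.
      by apply: subset_trans (subsetUr _ _); rewrite hle.
    - have -> : (i <= j) = false by lia.
      apply/negbTE/negP; rewrite subUset sub1set => /andP[xj _].
      by have [_] := hS j jm'; rewrite xj.
    - by rewrite subxx; lia.
  rewrite /h1; case: (leqP i m) => im'; first exact: hrk.
  rewrite cardsU1; have [_ ->] := hS m (leqnn m); rewrite hrk //; lia.
have memU B : reflect (exists2 i, i <= m & B = h i \/ B = x |: h i)
    (B \in \bigcup_(A in D) [set A; x |: A]).
  apply: (iffP bigcupP) => [[A AD]|[i im Bi]].
    move: AD; rewrite -hD => /imsetP[i _ ->]; rewrite !inE => Bi.
    exists (val i); first by rewrite -ltnS; apply: ltn_ord.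
    by case/orP: Bi => /eqP; [left|right].
  exists (h i); first by rewrite -hD; apply/imsetP; exists (inord i); rewrite //= inordK.
  by rewrite !inE; case: Bi => ->; rewrite eqxx ?orbT.
have C1P B : reflect (exists2 i, i <= m & B = h i \/ i = m /\ B = x |: h m) (B \in C1).
  apply: (iffP imsetP) => [[i _ ->]|[i im]].
    rewrite /h1; have [im|im] := leqP i m; first by exists (val i); rewrite // ; left.
    by exists m; rewrite //; right.
  case=> [->|[_ ->]].
    by exists (inord i); rewrite // /h1 /= inordK ?im // ltnS leqW.
  by exists ord_max; rewrite // /h1 /= ltnn.
(* For [m = 0] the second chain is empty. *)
case: m => [|m] in hD hle hrk Na hS sub1 h1 C1 KC1 memU C1P *.
  rewrite (_ : \bigcup_(A in D) _ = C1); first exact: tiled1.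
  apply/setP=> B; apply/memU/C1P=> -[i]; rewrite leqn0 => /eqP->.
    by case=> ->; exists 0 => //; [left|right].
  by case=> [->|[_ ->]]; exists 0 => //; [left|right].
pose C2 := [set x |: h (val i) | i : 'I_m.+1].
rewrite (_ : \bigcup_(A in D) _ = C1 :|: C2).
  apply: tiled_union; first exact: tiled1.
    apply: tiled1; exists m, (fun i => x |: h i), a.+1; split=> [//|i j im jm|i im|] /=; last by lia.
      have [iS xi] := hS i (leqW im); have [jS xj] := hS j (leqW jm).
      rewrite -hle ?leqW //; apply/idP/idP=> [s|]; last exact: setUS.
      by rewrite -(setU1K xi) -(setU1K xj); apply: setSD.
    by have [_ xi] := hS i (leqW im); rewrite cardsU1 xi hrk ?leqW //; lia.
  rewrite -setI_eq0; apply/eqP/setP=> B; rewrite !inE.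
  apply/negbTE/negP=> /andP[/C1P[i im hB] /imsetP[j _ Bj]].
  have jm : val j <= m by rewrite -ltnS; apply: ltn_ord.
  have [_ xj] := hS _ (leqW jm).
  case: hB => [hB|[_ hB]].
    by have [_] := hS i im; rewrite -hB Bj setU11.
  have [_ xm] := hS m.+1 (leqnn _).
  have : h m.+1 \subset h (val j) by rewrite -(setU1K xj) -Bj hB (setU1K xm).
  by rewrite hle // ?leqW // leqNgt ltnS jm.
apply/setP=> B; rewrite inE; apply/memU/orP=> [[i im]|].
  case=> ->; first by left; apply/C1P; exists i => //; left.
  have [->|im'] := eqVneq i m.+1; first by left; apply/C1P; exists m.+1 => //; right.
  right; apply/imsetP; exists (inord i); rewrite //= inordK //.
  by rewrite ltn_neqAle im'.
case=> [/C1P[i im]|/imsetP[i _ ->]].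
  by case=> [->|[_ ->]]; [exists i => //; left|exists m.+1 => //; right].
by exists (val i); [apply: ltnW; apply: ltn_ord|right].
Qed.

(** * What a tiling by centred Boolean lattices implies *)

Section Consequences.
Variables (T : finType) (le : rel T) (rk : T -> nat) (N : nat).
Hypothesis le_rk : forall x y, le x y -> x != y -> rk x < rk y.

Lemma boolean_chains D : sym_boolean le rk N D -> tiled (sym_chain le rk N) D.
Proof.
case=> J [f [a [fD fle frk Na]]]; rewrite -fD -powersetT.
have <- : (#|[set: J]| + a + a)%N = N by rewrite cardsT; lia.
apply: tiled_chain_map (boolean_lattice_chains _) => [A B _ _ fAB|A B _ _|A _].
- by apply/eqP; rewrite eqEsubset -!fle fAB fle subxx.
- exact: fle.
- by rewrite frk addnC.
Qed.

(** Every point is linked to the bottom, and the required bijection is between two singletons.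
    Antisymmetry comes from the strict growth of [rk]. *)
Lemma bounded_part (D : {set T}) (p0 p1 : T) : p0 \in D -> p1 \in D ->
  {in D, forall y, le p0 y && le y p1} -> (rk p0 + rk p1)%N = N ->
  poset_connected le D /\ symmetric_part le rk N D.
Proof.
move=> p0D p1D h e; split=> [A AD A0 AnD|].
  have [p0A|p0A] := boolP (p0 \in A).
    have /subsetPn[y yD yA] : ~~ (D \subset A).
      by apply: contra AnD => DA; rewrite eqEsubset AD.
    by exists p0, y; rewrite inE yD yA; split=> //; case/andP: (h y yD) => ->.
  have /set0Pn[x xA] := A0; exists x, p0; rewrite inE p0D p0A; split=> //.
  by case/andP: (h x (subsetP AD _ xA)) => ->; rewrite orbT.
have anti x y : le x y -> le y x -> x = y.
  move=> xy yx; apply/eqP/negPn/negP=> nxy; have := le_rk xy nxy.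
  by rewrite ltnNge ltnW // le_rk // eq_sym.
have m0 : minimals le D = [set p0].
  apply/setP=> x; rewrite !inE; apply/andP/eqP=> [[xD /forall_inP/(_ p0 p0D)]|->].
    by case/andP: (h x xD) => -> _ /= /eqP.
  split=> //; apply/forall_inP=> y yD; apply/implyP=> yp.
  by case/andP: (h y yD) => py _; rewrite (anti _ _ yp py).
have m1 : maximals le D = [set p1].
  apply/setP=> x; rewrite !inE; apply/andP/eqP=> [[xD /forall_inP/(_ p1 p1D)]|->].
    by case/andP: (h x xD) => _ -> /= /eqP.
  split=> //; apply/forall_inP=> y yD; apply/implyP=> yp.
  by case/andP: (h y yD) => _ py; rewrite (anti _ _ yp py).
exists (fun _ => p1); rewrite m0 m1; split=> [x y||x] /=.
- by move=> /set1P-> /set1P->.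
- by rewrite imset_set1.
by move=> /set1P->.
Qed.

Lemma covers_of_rank D x y : covers_in le D x y -> rk y = (rk x).+1 ->
  covers_in le [set: T] x y.
Proof.
case/and4P=> _ _ xy _ rxy; rewrite /covers_in !inE xy /=; apply/forall_inP=> z _.
apply/negP=> /andP[/andP[xz lxz] /andP[zy lzy]].
have := le_rk lxz xz; have := le_rk lzy zy.
by rewrite rxy ltnS => h1 h2; have := leq_trans h2 h1; rewrite ltnn.
Qed.

Lemma sym_boolean_part D : sym_boolean le rk N D ->
  [/\ poset_connected le D, is_boolean le D, symmetric_part le rk N D &
      forall x y, covers_in le D x y -> covers_in le [set: T] x y].
Proof.
case=> J [f [a [fD fle frk Na]]].
have fDA A : f A \in D by rewrite -fD imset_f.
have [] := @bounded_part D (f set0) (f setT) (fDA _) (fDA _).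
- by move=> y; rewrite -fD => /imsetP[A _ ->]; rewrite !fle sub0set subsetT.
- by rewrite !frk cards0 cardsT; lia.
move=> conn sym; split=> //.
  exists #|J|, (fun A : {set 'I_#|J|} => f (enum_rank @^-1: A)); split.
  - move=> A B fAB; have /eqP : enum_rank @^-1: A == enum_rank @^-1: B.
      by rewrite eqEsubset -!fle fAB fle subxx.
    by move/setP=> h; apply/setP=> i; have := h (enum_val i); rewrite !inE enum_valK.
  - rewrite -fD; apply/setP=> x; apply/imsetP/imsetP=> -[A _ ->].
      by exists (enum_rank @^-1: A).
    exists (enum_val @^-1: A) => //; congr f; apply/setP=> j.
    by rewrite !inE enum_rankK.
  - move=> A B; rewrite fle; apply/subsetP/subsetP=> h i; last by rewrite !inE; apply: h.
    by have := h (enum_val i); rewrite !inE enum_valK.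
move=> x y cxy; apply: (covers_of_rank cxy).
case/and4P: (cxy); rewrite -{1 2}fD => /imsetP[A _ ->] /imsetP[B _ ->].
rewrite /plt fle !frk => /andP[nAB AB] /forall_inP nz.
have AB' : A \proper B.
  by rewrite properEneq AB andbT; apply: contraNneq nAB => ->.
(* [b |: A] lies between [A] and [B] and differs from [A], so it is [B], which gives the rank
   step. *)
have /properP[_ [b bB bA]] := AB'.
have := nz (f (b |: A)) (fDA _); rewrite !fle subsetUr subUset sub1set bB AB !andbT.
rewrite negb_and !negbK => /orP[/eqP h|/eqP h].
  have : f (b |: A) = f A by rewrite h.
  move/(congr1 rk); rewrite !frk cardsU1 bA; lia.
by move/(congr1 rk): h; rewrite !frk cardsU1 bA; lia.
Qed.

Lemma sym_chain_part D : sym_chain le rk N D ->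
  [/\ poset_connected le D, is_chain le D, symmetric_part le rk N D &
      forall x y, covers_in le D x y -> covers_in le [set: T] x y].
Proof.
case=> m [h [a [hD hle hrk Na]]].
have hDi i : i <= m -> h i \in D.
  by move=> im; rewrite -hD; apply/imsetP; exists (inord i); rewrite //= inordK.
have Dh x : x \in D -> exists2 i, i <= m & x = h i.
  by rewrite -hD => /imsetP[i _ ->]; exists (val i); rewrite // -ltnS; apply: ltn_ord.
have [] := @bounded_part D (h 0) (h m) (hDi _ _) (hDi _ _) => //.
- by move=> y /Dh[i im ->]; rewrite !hle // im.
- by rewrite !hrk //; lia.
move=> conn sym; split=> //.
  by move=> x y /Dh[i im ->] /Dh[j jm ->]; rewrite !hle // leq_total.
move=> x y cxy; apply: (covers_of_rank cxy).
case/and4P: (cxy) => /Dh[i im ->] /Dh[j jm ->] /andP[nij]; rewrite hle // => ij /forall_inP nz.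
have ij' : i < j by rewrite ltn_neqAle ij andbT; apply: contraNneq nij => ->.
rewrite !hrk //; have [<-|ij1] := eqVneq i.+1 j; first by rewrite addnS.
have i1m : i.+1 <= m by apply: leq_trans jm.
have := nz (h i.+1) (hDi _ i1m); rewrite /plt !hle // leqnSn ij' !andbT.
rewrite negb_and !negbK => /orP[]/eqP/(congr1 rk); rewrite !hrk //; lia.
Qed.

Lemma SBD_of_tiled : tiled (sym_boolean le rk N) [set: T] -> has_SBD le rk N.
Proof.
move=> t; have [|P [PT KP]] := tiled_partition _ t.
  by move=> D [J [f [a [<- _ _ _]]]]; apply/set0Pn; exists (f set0); apply: imset_f.
exists P; split=> [|D /KP/sym_boolean_part[]//]; split=> // D /KP/sym_boolean_part[? ? ? ?].
by split.
Qed.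

Lemma SCD_of_tiled : tiled (sym_chain le rk N) [set: T] -> has_SCD le rk N.
Proof.
move=> t; have [|P [PT KP]] := tiled_partition _ t.
  move=> D [m [h [a [<- _ _ _]]]]; apply/set0Pn; exists (h 0).
  by apply/imsetP; exists ord0.
exists P; split=> [|D /KP/sym_chain_part[]//]; split=> // D /KP/sym_chain_part[? ? ? ?].
by split.
Qed.

(** * Rank numbers and Sperner properties from symmetric chains *)

Section RankNumbers.
Hypothesis chains : tiled (sym_chain le rk N) [set: T].

Let count (X : {set T}) (j : nat) := #|[set x in X | rk x == j]|.

Lemma chain_count D : sym_chain le rk N D ->
  exists2 a, a + a <= N & forall j, count D j = ((a <= j) && (j <= N - a)).
Proof.
case=> m [h [a [hD hle hrk Na]]]; exists a => [|j]; first by lia.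
have hjE : [set x in D | rk x == j] =
    if (a <= j) && (j <= N - a) then [set h (j - a)] else set0.
  apply/setP=> x; rewrite inE -hD; apply/andP/idP.
    case=> /imsetP[i _ ->]; have im : val i <= m by rewrite -ltnS; apply: ltn_ord.
    rewrite hrk // => /eqP<-; rewrite leq_addr addKn.
    by rewrite (_ : a + val i <= N - a) ?inE //; lia.
  case: ifP => [/andP[aj jN]|]; last by rewrite inE.
  rewrite inE => /eqP->; have jam : j - a <= m by lia.
  rewrite hrk // subnKC ?eqxx //; split=> //.
  by apply/imsetP; exists (inord (j - a)); rewrite //= inordK.
by rewrite /count hjE; case: ifP => _; rewrite ?cards1 ?cards0.
Qed.

Lemma countU (X Y : {set T}) j : [disjoint X & Y] -> count (X :|: Y) j = (count X j + count Y j)%N.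
Proof.
move=> dXY; rewrite /count (_ : [set x in X :|: Y | _] =
  [set x in X | rk x == j] :|: [set x in Y | rk x == j]); last first.
  by apply/setP=> x; rewrite !inE andb_orl.
rewrite cardsU (_ : _ :&: _ = set0) ?cards0 ?subn0 //.
apply/setP=> x; rewrite !inE; apply/negbTE/negP=> /andP[/andP[xX _] /andP[xY _]].
by have := disjointFr dXY xX; rewrite xY.
Qed.

(** A centred chain meets mirror ranks together, and with rank [i] it meets every rank from [i] to
    [N - i]; both facts add up over the chains. *)
Lemma tiled_count X : tiled (sym_chain le rk N) X ->
  (forall j, j <= N -> count X j = count X (N - j)) /\
  (forall i j, i <= j -> j + i <= N -> count X i <= count X j).
Proof.
elim=> [|D Y KD _ [IH1 IH2] dDY].
  have e j : count set0 j = 0 by apply: eq_card0 => x; rewrite !inE.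
  by split=> *; rewrite !e.
have [a aN cD] := chain_count KD.
split=> [j jN|i j ij jiN]; rewrite !countU // !cD.
  by rewrite (IH1 j) //; congr (nat_of_bool _ + _)%N; lia.
apply: leq_add; last exact: IH2.
have : (a <= i) && (i <= N - a) -> (a <= j) && (j <= N - a) by lia.
by case: (_ && _) => // ->.
Qed.

Lemma rank_numberE j : rank_number rk j = count [set: T] j.
Proof. by apply: eq_card => x; rewrite !inE. Qed.

Lemma rank_symmetric_of_chains : rank_symmetric rk N.
Proof. by move=> j jN; rewrite !rank_numberE; apply: (tiled_count chains).1. Qed.

Lemma rank_unimodal_of_chains : rank_unimodal rk N.
Proof.
have [sym up] := tiled_count chains.
(* The peak is the middle rank. Above it indices are reflected, except for the lower of the two
   middle ranks when [N] is odd. *)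
exists N./2; split=> i j h; rewrite !rank_numberE; first by apply: up; lia.
move=> jN; rewrite [count _ j]sym //.
have [ij|ij] := leqP N (i + i); first by rewrite [count _ i]sym; [apply: up; lia|lia].
have [->|nij] := eqVneq i j; first by rewrite -sym.
by apply: up; lia.
Qed.

Definition rank_window (b k : nat) (X : {set T}) := [set x in X | b <= rk x < b + k].

Lemma rank_windowU b k (X Y : {set T}) : [disjoint X & Y] ->
  #|rank_window b k (X :|: Y)| = (#|rank_window b k X| + #|rank_window b k Y|)%N.
Proof.
move=> dXY; rewrite (_ : rank_window b k (X :|: Y) = rank_window b k X :|: rank_window b k Y).
  rewrite cardsU (_ : _ :&: _ = set0) ?cards0 ?subn0 //.
  apply/setP=> x; rewrite !inE; apply/negbTE/negP=> /andP[/andP[xX _] /andP[xY _]].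
  by have := disjointFr dXY xX; rewrite xY.
by apply/setP=> x; rewrite !inE andb_orl.
Qed.

(* The [k] middle ranks meet every symmetric chain in as many elements as a
   [k]-family possibly can. *)
Lemma k_family_window k F X : k <= N -> k_family le k F -> tiled (sym_chain le rk N) X ->
  #|F :&: X| <= #|rank_window (N.+1 - k)./2 k X|.
Proof.
move=> kN kF; elim=> [|D Y KD _ IH dDY]; first by rewrite setI0 cards0.
rewrite rank_windowU // setIUr; apply: leq_trans (leq_card_setU _ _) _.
apply: leq_add => //; have [_ chD _ _] := sym_chain_part KD.
have FDk : #|F :&: D| <= k.
  apply: kF; first exact: subsetIl.
  by move=> x y /setIP[_ xD] /setIP[_ yD]; apply: chD.
case: KD => m [h [a [hD hle hrk Na]]].
(* The window consists of the ranks from [b] to [b + k - 1]. A centred chain with at most [k]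
   elements lies inside it, a longer one crosses all its [k] ranks. *)
set b := (N.+1 - k)./2.
have [mk|km] := leqP m.+1 k.
  apply: leq_trans (subset_leq_card (subsetIr _ _)) (subset_leq_card _).
  apply/subsetP=> x xD; rewrite inE xD /=; move: xD; rewrite -hD => /imsetP[i _ ->].
  have im : val i <= m by rewrite -ltnS; apply: ltn_ord.
  by rewrite hrk //; move: (val i) im => v vm; rewrite /b; clear -vm mk kN Na; lia.
apply: leq_trans FDk _; rewrite -[X in X <= _]card_ord.
have hi (i : 'I_k) : b + i - a <= m /\ a <= b + i.
  have ik := ltn_ord i; by rewrite /b; clear -ik km kN Na; lia.
rewrite -(@card_imset _ _ (fun i : 'I_k => h (b + i - a))).
  apply/subset_leq_card/subsetP=> _ /imsetP[i _ ->]; have [im ai] := hi i.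
  rewrite inE hrk // subnKC // leq_addr ltn_add2l ltn_ord -hD !andbT.
  by apply/imsetP; exists (inord (b + i - a)); rewrite //= inordK.
move=> i j /(congr1 rk); have [im ai] := hi i; have [jm aj] := hi j.
by rewrite !hrk // !subnKC // => /addnI/val_inj.
Qed.

Lemma rank_window_sum b k : #|rank_window b k setT| = (\sum_(b <= j < b + k) rank_number rk j)%N.
Proof.
elim: k => [|k IH]; first by rewrite addn0 big_geq // eq_card0 // => x; rewrite !inE addn0; lia.
rewrite addnS big_nat_recr ?leq_addr //= -IH -cardsUI.
rewrite (_ : _ :&: _ = set0) ?cards0 ?addn0.
  by apply: eq_card => x; rewrite !inE /=; lia.
by apply/setP=> x; rewrite !inE /=; lia.
Qed.

(** Greedy exchange: [u] holds the entries not chosen, and the largest entry of [s] is either in [t]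
    or can replace an entry of [t]. *)
Lemma sumn_take_sort (s t u : seq nat) : perm_eq (t ++ u) s ->
  (\sum_(r <- t) r <= \sum_(r <- take (size t) (sort geq s)) r)%N.
Proof.
move=> p; have {p} : perm_eq (t ++ u) (sort geq s) by rewrite perm_sym perm_sort perm_sym.
have geq_tr : transitive geq by move=> y x z /= h1 h2; apply: leq_trans h2 h1.
have : sorted geq (sort geq s) by apply: sort_sorted => x y; rewrite /= leq_total.
elim: (sort geq s) t u => [|x l IH] t u srt p.
  by have := perm_size p; rewrite size_cat; case: t {p} => // _; rewrite big_nil.
have lx y : y \in l -> y <= x by move: srt => /= /(order_path_min geq_tr)/allP; apply.
have srt' : sorted geq l by apply: path_sorted srt.
have step t' u' : perm_eq (t' ++ u') l ->
    (\sum_(r <- t') r <= \sum_(r <- take (size t') l) r)%N by apply: IH.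
have [xt|xt] := boolP (x \in t).
  have pt := perm_to_rem xt; rewrite (perm_size pt) (perm_big _ pt) /= !big_cons leq_add2l.
  apply: (step _ u); rewrite -(perm_cons x) -cat_cons.
  by apply: perm_trans p; rewrite perm_cat2r perm_sym.
case: t xt p => [|y t] xt p; first by rewrite big_nil.
have xu : x \in u.
  have : x \in (y :: t) ++ u by rewrite (perm_mem p) inE eqxx.
  by rewrite mem_cat (negPf xt).
have yl : y \in l.
  have : y \in x :: l by rewrite -(perm_mem p) inE eqxx.
  by rewrite inE; case: eqP => // yx; rewrite -yx inE eqxx in xt.
rewrite /= !big_cons; apply: leq_add; first exact: lx.
apply: (step _ (y :: rem x u)); rewrite -(perm_cons x); apply: perm_trans p.
have pu := perm_to_rem xu; rewrite perm_sym.
have h1 : perm_eq ((y :: t) ++ u) ((y :: t) ++ x :: rem x u) by rewrite perm_cat2l.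
apply: perm_trans h1 _; rewrite -[X in perm_eq _ X]/([:: x] ++ (t ++ y :: rem x u)).
by apply/seq.permP=> P; rewrite /= !count_cat /=; lia.
Qed.

(** The upper bound compares with the [k] middle ranks, whose sum is at most that of the [k] largest
    rank numbers. It is attained by a union of ranks, because a chain has at most one element in
    each rank. *)
Lemma strongly_sperner_of_chains : strongly_sperner le rk N.
Proof.
move=> k /andP[k1 kN]; set rs := [seq rank_number rk j | j <- iota 0 N.+1].
split; last first.
  move=> F kF; have := k_family_window kN kF chains; rewrite setIT rank_window_sum.
  move/leq_trans; apply; set b := (_)./2.
  have bk : b + k <= N.+1 by rewrite /b; lia.
  have e : (\sum_(b <= j < b + k) rank_number rk j =
            \sum_(r <- take k (drop b rs)) r)%N.
    rewrite /rs -map_drop -map_take big_map drop_iota take_iota add0n.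
    by rewrite /index_iota addKn (minn_idPl _) //; lia.
  have sz : size (take k (drop b rs)) = k.
    by rewrite size_takel // size_drop size_map size_iota; lia.
  rewrite e /sum_largest_ranks -{2}sz.
  apply: (@sumn_take_sort _ _ (take b rs ++ drop k (drop b rs))).
  by rewrite perm_catCA catA -catA cat_take_drop cat_take_drop.
(* Ranks are sorted by their size, so that the largest rank numbers come with the ranks realising
   them. *)
pose js := take k (sort (relpre (rank_number rk) geq) (iota 0 N.+1)).
have js_uniq : uniq js by rewrite take_uniq // sort_uniq iota_uniq.
have szjs : size js <= k by rewrite size_take_min geq_minl.
exists [set x | rk x \in js]; split.
  move=> C CF chC; have inj : {in C &, injective rk}.
    move=> x y xC yC rxy; apply/eqP/negPn/negP=> nxy.
    case/orP: (chC x y xC yC) => h; [have := le_rk h nxy|have := le_rk h _].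
      by rewrite rxy ltnn.
    by rewrite eq_sym rxy ltnn => /(_ nxy).
  rewrite cardE -(size_map rk); apply: leq_trans szjs; apply: uniq_leq_size.
    by rewrite map_inj_in_uniq ?enum_uniq // => x y; rewrite !mem_enum; apply: inj.
  move=> j /mapP[x]; rewrite mem_enum => xC ->.
  by have := subsetP CF x xC; rewrite inE.
rewrite /sum_largest_ranks sort_map -map_take big_map -/js.
elim: js js_uniq {szjs} => [|j l IH] /=.
  by rewrite big_nil eq_card0 // => x; rewrite inE.
case/andP=> jl ul; rewrite big_cons -IH // -cardsUI.
rewrite (_ : _ :&: _ = set0) ?cards0 ?addn0.
  by apply: eq_card => x; rewrite !inE.
by apply/setP=> x; rewrite !inE; case: eqP => // ->; rewrite (negPf jl).
Qed.

End RankNumbers.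

(** * The gamma expansion of the rank-generating polynomial *)

Section Gamma.
Import GRing.Theory.
Local Open Scope ring_scope.

Lemma sym_boolean_gf D : sym_boolean le rk N D -> exists2 a, (a + a <= N)%N &
  \sum_(x in D) ('X^(rk x) : {poly int}) = 'X^a * (1 + 'X) ^+ (N - 2 * a).
Proof.
case=> J [f [a [fD fle frk Na]]]; exists a; first by lia.
have fI : injective f.
  by move=> A B fAB; apply/eqP; rewrite eqEsubset -!fle fAB fle subxx.
have -> : (N - 2 * a)%N = #|J| by lia.
rewrite -fD big_imset /=; last by move=> A B _ _; apply: fI.
under eq_bigr => A _ do rewrite frk exprD.
rewrite -mulr_sumr; congr (_ * _).
transitivity (\prod_(j : J) ('X + 1 : {poly int})).
  rewrite bigA_distr; apply: eq_big => [A|A _]; first by rewrite inE.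
  by rewrite -big_mkcond /= prodr_const.
by rewrite prodr_const addrC.
Qed.

(** The coefficient [c j] counts the parts whose bottom has rank [j]. *)
Lemma tiled_gf X : tiled (sym_boolean le rk N) X -> exists c : nat -> nat,
  \sum_(x in X) ('X^(rk x) : {poly int}) =
  \sum_(j < N./2.+1) ('X^j * (1 + 'X) ^+ (N - 2 * j)) *+ c j.
Proof.
elim=> [|D Y KD _ [c cE] dDY].
  by exists (fun _ => 0%N); rewrite big_set0 big1.
have [a aN aE] := sym_boolean_gf KD.
have aN' : (a < N./2.+1)%N by lia.
exists (fun j => (j == a) + c j)%N.
rewrite (eq_bigl [predU D & Y]) => [|x]; last by rewrite !inE.
rewrite bigU //= cE aE; under [RHS]eq_bigr => j _ do rewrite mulrnDr.
rewrite big_split /=; congr (_ + _).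
rewrite (bigD1 (Ordinal aN')) //= eqxx mulr1n big1 ?addr0 // => j ja.
by rewrite (_ : (val j == a) = false) //; apply/negbTE; apply: contraNneq ja => /esym ja; apply/eqP/val_inj.
Qed.

Lemma gamma_of_tiled : tiled (sym_boolean le rk N) setT -> gamma_nonnegative rk N.
Proof.
move=> t; have [c cE] := tiled_gf t; exists c; rewrite -cE.
have rkN x : (rk x < N.+1)%N.
  have : x \in [set: T] by [].
  elim: t => [|D Y [J [f [a [<- _ frk Na]]]] _ IH _]; first by rewrite inE.
  rewrite inE => /orP[/imsetP[A _ ->]|//]; rewrite frk.
  have AJ : (#|A| <= #|J|)%N by apply: max_card.
  by clear -AJ Na; lia.
rewrite (partition_big (fun x => inord (rk x) : 'I_N.+1) xpredT) //=.
apply: eq_bigr => j _; rewrite (eq_bigr (fun _ => 'X^j)); last first.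
  by move=> x /andP[_ /eqP<-]; rewrite inordK.
rewrite sumr_const; congr (_ *+ _); apply: eq_card => x.
by rewrite !inE unfold_in in_setT -(inj_eq val_inj) /= inordK.
Qed.

End Gamma.

Theorem consequences_of_tiling : tiled (sym_boolean le rk N) setT ->
  has_SBD le rk N /\ has_SCD le rk N /\ strongly_sperner le rk N /\
  rank_symmetric rk N /\ rank_unimodal rk N /\ gamma_nonnegative rk N.
Proof.
move=> tB; have tC := tiled_refine boolean_chains tB.
split; first exact: SBD_of_tiled.
split; first exact: SCD_of_tiled.
split; first exact: strongly_sperner_of_chains.
split; first exact: rank_symmetric_of_chains.
split; first exact: rank_unimodal_of_chains.
exact: gamma_of_tiled.
Qed.

End Consequences.

(** * Reflections among coloured permutations *)

Section ColoredPermutations.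
Import GroupScope GRing.Theory.
Variables (I : finType) (C : finZmodType).
Local Notation pt := (I * C)%type.
Implicit Types (x y p q r : pt) (s c : C) (u v w t : {perm pt}).

Definition shift c x : pt := (x.1, x.2 + c)%R.

Lemma shift0 x : shift 0%R x = x.
Proof. by case: x => i c; rewrite /shift addr0. Qed.

Lemma shiftD c c' x : shift c (shift c' x) = shift (c' + c)%R x.
Proof. by rewrite /shift /= addrA. Qed.

Lemma shift_eq x c c' : (shift c x == shift c' x) = (c == c').
Proof.
by apply/eqP/eqP=> [[/addrI]|->].
Qed.

Lemma shift_id x c : (shift c x == x) = (c == 0%R).
Proof. by rewrite -{2}[x]shift0 shift_eq. Qed.

Lemma same_line x y : x.1 = y.1 -> exists c, y = shift c x.
Proof.
case: x y => i a [j b] /= ->; exists (b - a)%R.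
by rewrite /shift /= addrC subrK.
Qed.

(* A monomial matrix is a permutation of the coloured points [(i, c)], standing for the
   multiples of the basis vectors by roots of unity, that commutes with all colour
   shifts. Permutations act on the right: [(v * w) x = w (v x)]. *)
Definition equivariant w := forall c x, w (shift c x) = shift c (w x).

Lemma equivariant_ext v w : equivariant v -> equivariant w ->
  (forall i, exists2 x, x.1 = i & v x = w x) -> v = w.
Proof.
move=> ev ew h; apply/permP=> y; have [x xy vw] := h y.1.
by have [c ->] := same_line xy; rewrite ev ew vw.
Qed.

Lemma equivariant1 : equivariant 1.
Proof. by move=> c x; rewrite !perm1. Qed.

Lemma equivariantM v w : equivariant v -> equivariant w -> equivariant (v * w).
Proof. by move=> ev ew c x; rewrite !permM ev ew. Qed.

Lemma equivariantV w : equivariant w -> equivariant w^-1.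
Proof. by move=> ew c x; apply: (@perm_inj _ w); rewrite ew !permKV. Qed.

Lemma equivariant_line w x y : equivariant w -> ((w x).1 == (w y).1) = (x.1 == y.1).
Proof.
move=> ew; apply/eqP/eqP=> /same_line[c].
  by rewrite -ew => /perm_inj ->.
by move->; rewrite ew.
Qed.

(* Swaps [x] and [y] equivariantly; the intended case is [x.1 != y.1], otherwise it
   shifts the common line. *)
Definition refl_fun x y z : pt :=
  if z.1 == x.1 then shift (z.2 - x.2)%R y
  else if z.1 == y.1 then shift (z.2 - y.2)%R x else z.

Lemma refl_fun_inj x y : injective (refl_fun x y).
Proof.
have e (a b c d : C) : (a + (b - c) = a + (d - c) -> b = d)%R.
  by move=> /addrI/addIr.
case: x y => [xi xc] [yi yc] [i c] [j d]; rewrite /refl_fun /shift /=.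
have [ei|n1] := eqVneq i xi; have [ej|n2] := eqVneq j xi.
- by case=> /e ->; rewrite ei ej.
- have [e1|n3] := eqVneq j yi; first by case=> h; rewrite e1 h eqxx in n2.
  by case=> h; rewrite h eqxx in n3.
- have [e1|n3] := eqVneq i yi; first by case=> h; rewrite e1 h eqxx in n1.
  by case=> h; rewrite h eqxx in n3.
have [e1|n3] := eqVneq i yi; have [e2|n4] := eqVneq j yi.
- by case=> /e ->; rewrite e1 e2.
- by case=> h; rewrite h eqxx in n2.
- by case=> h; rewrite h eqxx in n1.
by [].
Qed.

Definition refl x y : {perm pt} := perm (@refl_fun_inj x y).

Lemma refl_l x y : refl x y x = y.
Proof. by rewrite permE /refl_fun eqxx subrr shift0. Qed.

Lemma refl_r x y : x.1 != y.1 -> refl x y y = x.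
Proof. by rewrite permE /refl_fun eq_sym => /negPf->; rewrite eqxx subrr shift0. Qed.

Lemma refl_out x y z : z.1 != x.1 -> z.1 != y.1 -> refl x y z = z.
Proof. by rewrite permE /refl_fun => /negPf-> /negPf->. Qed.

Lemma refl_equivariant x y : equivariant (refl x y).
Proof.
move=> c z; rewrite !permE /refl_fun [(shift c z).1]/= [(shift c z).2]/=.
by case: ifP => _; [|case: ifP => _ //]; rewrite shiftD [(z.2 + c)%R]addrC -addrA addrC.
Qed.

Lemma reflC x y : x.1 != y.1 -> refl x y = refl y x.
Proof.
move=> xy; apply: equivariant_ext; try exact: refl_equivariant.
move=> i; have [->|nx] := eqVneq i x.1.
  by exists x; rewrite // refl_l refl_r // eq_sym.
have [->|ny] := eqVneq i y.1; first by exists y; rewrite // refl_l refl_r.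
by exists (i, 0%R); rewrite // !refl_out.
Qed.

Lemma refl_shift c x y : x.1 != y.1 -> refl (shift c x) (shift c y) = refl x y.
Proof.
move=> xy; apply: equivariant_ext; try exact: refl_equivariant.
move=> i; have [->|nx] := eqVneq i x.1.
  by exists (shift c x); rewrite // refl_l refl_equivariant refl_l.
have [->|ny] := eqVneq i y.1.
  by exists (shift c y); rewrite // refl_r // refl_equivariant refl_r.
by exists (i, 0%R); rewrite // !refl_out.
Qed.

Lemma reflK x y : x.1 != y.1 -> refl x y * refl x y = 1.
Proof.
move=> xy; apply: equivariant_ext; first by apply: equivariantM; apply: refl_equivariant.
  exact: equivariant1.
move=> i; have [->|nx] := eqVneq i x.1.
  by exists x; rewrite // permM perm1 refl_l refl_r.
have [->|ny] := eqVneq i y.1; first by exists y; rewrite // permM perm1 refl_r // refl_l.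
by exists (i, 0%R); rewrite // permM perm1 !refl_out.
Qed.

Lemma reflV x y : x.1 != y.1 -> (refl x y)^-1 = refl x y.
Proof. by move=> xy; apply/eqP; rewrite eq_invg_mul reflK. Qed.

(** The Hurwitz move: a reflection passes an equivariant factor at the price of relabelling its two
    points. *)
Lemma reflJ x y w : equivariant w -> x.1 != y.1 -> refl x y ^ w = refl (w x) (w y).
Proof.
move=> ew xy; have wxy : (w x).1 != (w y).1 by rewrite equivariant_line.
apply: equivariant_ext; last 1 first.
- move=> i; pose z := w^-1 (i, 0%R).
  have zi : (w z).1 = i by rewrite permKV.
  have [zx|nx] := eqVneq z.1 x.1.
    exists (w x); first by rewrite -zi; apply/eqP; rewrite equivariant_line // zx.
    by rewrite conjgE !permM permK !refl_l.
  have [zy|ny] := eqVneq z.1 y.1.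
    exists (w y); first by rewrite -zi; apply/eqP; rewrite equivariant_line // zy.
    by rewrite conjgE !permM permK !refl_r.
  by exists (w z); rewrite // conjgE !permM permK !refl_out // equivariant_line.
- by apply: equivariantM; [apply: equivariantV|apply: equivariantM; [apply: refl_equivariant|]].
- exact: refl_equivariant.
Qed.

(** * The reflection group, its length function and its absolute order *)

Definition refls : {set {perm pt}} :=
  [set t | [exists x, [exists y, (x.1 != y.1) && (t == refl x y)]]].

Lemma reflsP t :
  reflect (exists x y, x.1 != y.1 /\ t = refl x y) (t \in refls).
Proof.
rewrite inE; apply: (iffP existsP) => [[x /existsP[y /andP[xy /eqP->]]]|[x [y [xy ->]]]].
  by exists x, y.
by exists x; apply/existsP; exists y; rewrite xy /=.
Qed.

Lemma mem_refl x y : x.1 != y.1 -> refl x y \in refls.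
Proof. by move=> xy; apply/reflsP; exists x, y. Qed.

Lemma refls_equivariant t : t \in refls -> equivariant t.
Proof. by case/reflsP=> x [y [_ ->]]; apply: refl_equivariant. Qed.

Lemma refls_move t p : t \in refls -> t p != p -> (p.1 != (t p).1) /\ t = refl p (t p).
Proof.
case/reflsP=> x [y [xy ->]].
have [e|nx] := eqVneq x.1 p.1.
  have [c ->] := same_line e; rewrite refl_equivariant refl_l => _; split=> //.
  by rewrite refl_shift.
have [e|ny] := eqVneq y.1 p.1.
  have [c ->] := same_line e; rewrite refl_equivariant refl_r //= => _.
  by split; rewrite 1?eq_sym // reflC // refl_shift // eq_sym.
by rewrite refl_out ?eqxx // eq_sym.
Qed.

(** Given by generators, because the length arguments start from words; [mem_W] later identifies it
    as the kernel of [weight], that is, as [G(d,d,n)]. *)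
Definition W := <<refls>>%G.

Lemma refls_W t : t \in refls -> t \in W.
Proof. exact: mem_gen. Qed.

Lemma refl_W x y : x.1 != y.1 -> refl x y \in W.
Proof. by move=> xy; apply/refls_W/mem_refl. Qed.

Lemma words_W k w : w \in refls ^+ k -> w \in W.
Proof.
elim: k w => [|k IH] w; first by rewrite expg0 => /set1gP ->; apply: group1.
by rewrite expgS => /mulsgP[t v /refls_W tW /IH vW ->]; rewrite groupM.
Qed.

Lemma W_words w : w \in W -> exists k, w \in refls ^+ k.
Proof.
case/gen_prodgP=> k [c ct ->]; exists k.
elim: k c ct => [|k IH] c ct; first by rewrite big_ord0 expg0 inE.
by rewrite big_ord_recl expgS; apply: mem_mulg; [apply: ct|apply: IH => i; apply: ct].
Qed.

Lemma words_equivariant k w : w \in refls ^+ k -> equivariant w.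
Proof.
elim: k w => [|k IH] w; first by rewrite expg0 => /set1gP ->; apply: equivariant1.
by rewrite expgS => /mulsgP[t v /refls_equivariant te /IH ve ->]; apply: equivariantM.
Qed.

Lemma W_equivariant w : w \in W -> equivariant w.
Proof. by case/W_words=> k /words_equivariant. Qed.

Lemma refls_J t w : equivariant w -> t \in refls -> t ^ w \in refls.
Proof.
move=> ew /reflsP[x [y [xy ->]]]; rewrite reflJ //.
by apply: mem_refl; rewrite equivariant_line.
Qed.

Lemma words_J k v w : equivariant w -> v \in refls ^+ k -> v ^ w \in refls ^+ k.
Proof.
move=> ew; elim: k v => [|k IH] v; first by rewrite expg0 => /set1gP ->; rewrite conj1g inE.
rewrite !expgS => /mulsgP[t v' tT v'k ->]; rewrite conjMg.
by apply: mem_mulg; [apply: refls_J|apply: IH].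
Qed.

Lemma words_add k l v w : v \in refls ^+ k -> w \in refls ^+ l -> v * w \in refls ^+ (k + l).
Proof. by move=> vk wl; rewrite expgnDr; apply: mem_mulg. Qed.

(** [refls ^+ k] is the set of products of [k] reflections. Outside [W] the value 0 is a default. *)
Definition len w : nat :=
  if @idP (w \in W) is ReflectT h then ex_minn (W_words h) else 0.

Lemma len_word w : w \in W -> w \in refls ^+ len w.
Proof. by rewrite /len; case: {-}_ / idP => // h _; case: ex_minnP. Qed.

Lemma len_min k w : w \in refls ^+ k -> len w <= k.
Proof.
move=> wk; rewrite /len; case: {-}_ / idP => // h.
by case: ex_minnP => m _; apply.
Qed.

Lemma len1 : len 1 = 0.
Proof. by apply/eqP; rewrite -leqn0; apply: len_min; rewrite expg0 inE. Qed.

Lemma len_eq0 w : w \in W -> len w = 0 -> w = 1.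
Proof. by move/len_word => h e; move: h; rewrite e expg0 => /set1gP. Qed.

Lemma lenM v w : v \in W -> w \in W -> len (v * w) <= len v + len w.
Proof. by move=> vW wW; apply/len_min/words_add; apply: len_word. Qed.

Lemma lenJ v w : v \in W -> w \in W -> len (v ^ w) = len v.
Proof.
have H u z : u \in W -> z \in W -> len (u ^ z) <= len u.
  by move=> uW zW; apply: len_min; apply: words_J; [apply: W_equivariant|apply: len_word].
move=> vW wW; apply/eqP; rewrite eqn_leq H //= -{1}[v](conjgK w) H ?groupV //.
by rewrite groupJ.
Qed.

Lemma len_conj v w : v \in W -> w \in W -> len (v * w) = len (w * v).
Proof. by move=> vW wW; rewrite -(@lenJ (v * w) v) ?groupM // conjgE !mulgA mulVg mul1g. Qed.

Lemma len_refls t : t \in refls -> len t = 1%N.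
Proof.
move=> tT; apply/eqP; rewrite eqn_leq len_min ?expg1 //= lt0n.
apply/eqP=> /(len_eq0 (refls_W tT)) e; case/reflsP: tT => x [y [xy e']].
by move: (refl_l x y); rewrite -e' e perm1 => e''; rewrite e'' eqxx in xy.
Qed.

Lemma len_refl x y : x.1 != y.1 -> len (refl x y) = 1%N.
Proof. by move/mem_refl/len_refls. Qed.

Definition le u v := len v == (len u + len (u^-1 * v)).

Lemma leP u v : u \in W -> v \in W ->
  le u v -> exists2 z, z \in W & v = u * z /\ len v = len u + len z.
Proof.
move=> uW vW /eqP e; exists (u^-1 * v); first by rewrite groupM ?groupV.
by rewrite mulKVg.
Qed.

(** Length is invariant under conjugation, so a left factor with additive lengths is also a right
    factor. *)
Lemma leP' u v : u \in W -> v \in W ->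
  le u v -> exists2 z, z \in W & v = z * u /\ len v = len u + len z.
Proof.
move=> uW vW /eqP e; exists (v * u^-1); first by rewrite groupM ?groupV.
by rewrite mulgKV; split=> //; rewrite e len_conj ?groupV.
Qed.

Lemma leI u v z : u \in W -> z \in W -> v = u * z -> len u + len z <= len v -> le u v.
Proof.
move=> uW zW -> h; rewrite /le mulKg; apply/eqP/eqP.
by rewrite eqn_leq h lenM.
Qed.

Lemma leI' u v z : u \in W -> z \in W -> v = z * u -> len u + len z <= len v -> le u v.
Proof.
move=> uW zW -> h; apply: (@leI _ _ (z ^ u)); rewrite ?groupJ //.
  by rewrite conjgE !mulgA mulgV mul1g.
by rewrite lenJ.
Qed.

Lemma le_refl w : le w w.
Proof. by rewrite /le mulVg len1 addn0. Qed.

Lemma le1 w : le 1 w.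
Proof. by rewrite /le invg1 mul1g len1. Qed.

Lemma le_trans v u w : u \in W -> v \in W -> w \in W -> le u v -> le v w -> le u w.
Proof.
move=> uW vW wW /(leP uW vW)[a aW [e1 e2]] /(leP vW wW)[b bW [e3 e4]].
apply: (@leI _ _ (a * b)); rewrite ?groupM //; first by rewrite e3 e1 mulgA.
by rewrite e4 e2 -addnA leq_add2l lenM.
Qed.

Lemma le_len u v : le u v -> len u <= len v.
Proof. by move/eqP->; apply: leq_addr. Qed.

Lemma le_len_eq u v : u \in W -> v \in W -> le u v -> len v <= len u -> u = v.
Proof.
move=> uW vW /(leP uW vW)[a aW [-> ->]]; rewrite -{2}[len u]addn0 leq_add2l leqn0.
by move=> /eqP/(len_eq0 aW) ->; rewrite mulg1.
Qed.

(* The diagonal element turning the line of [x] by [s] and that of [y] by [- s]. *)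
Definition dg x y s : {perm pt} := refl x y * refl y (shift s x).

Lemma dg_l x y s : dg x y s x = shift s x.
Proof. by rewrite permM !refl_l. Qed.

Lemma dg_r x y s : x.1 != y.1 -> dg x y s y = shift (- s)%R y.
Proof.
move=> xy; rewrite permM refl_r //.
have {2}-> : x = shift (- s)%R (shift s x) by rewrite shiftD subrr shift0.
by rewrite refl_equivariant refl_r // eq_sym.
Qed.

Lemma dg_out x y s z : z.1 != x.1 -> z.1 != y.1 -> dg x y s z = z.
Proof. by move=> zx zy; rewrite permM !refl_out. Qed.

Lemma dg_equivariant x y s : equivariant (dg x y s).
Proof. by apply: equivariantM; apply: refl_equivariant. Qed.

Lemma dg_W x y s : x.1 != y.1 -> dg x y s \in W.
Proof. by move=> xy; rewrite groupM // refl_W // eq_sym. Qed.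

Lemma len_dg x y s : x.1 != y.1 -> len (dg x y s) <= 2.
Proof.
move=> xy; have yx : y.1 != (shift s x).1 by rewrite eq_sym.
by apply: leq_trans (lenM (refl_W xy) (refl_W yx)) _; rewrite !len_refl.
Qed.

Lemma refl_shift_r x y s : x.1 != y.1 -> refl x (shift s y) = refl (shift (- s)%R x) y.
Proof.
move=> xy; rewrite -(@refl_shift s (shift (- s)%R x)) //.
by rewrite shiftD addNr shift0.
Qed.

Lemma dgE x y s : x.1 != y.1 -> dg x y s = refl x y * refl x (shift (- s)%R y).
Proof. by move=> xy; rewrite refl_shift_r // opprK /dg [in LHS](reflC (y := shift s x)) // eq_sym. Qed.

(** * Normal forms of words relative to a point *)

Lemma refl_swap p x y : p.1 != x.1 -> p.1 != y.1 -> x.1 != y.1 ->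
  refl p x * refl p y = refl x y * refl p x.
Proof.
move=> px py xy; have := reflJ (@refl_equivariant p x) py.
rewrite refl_l refl_out 1?eq_sym // 1?eq_sym // => <-.
by rewrite conjgE reflV // -!mulgA reflK // mulg1.
Qed.

Lemma words1 k x y v : x.1 != y.1 -> v \in refls ^+ k -> v * refl x y \in refls ^+ k.+1.
Proof. by move=> xy vk; rewrite expgSr mem_mulg // mem_refl. Qed.

(* Hurwitz moves push all factors moving [p] to the right; two factors that join [p]
   to different lines can be exchanged for one that does not move [p], and three that
   join it to the same line for a single one. *)
Lemma factor_moving_point k w p : w \in refls ^+ k ->
  [\/ exists2 l, l <= k & w \in refls ^+ l /\ w p = p,
   exists v l y, [/\ v \in refls ^+ l, l.+1 <= k, v p = p, p.1 != y.1 & w = v * refl p y]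
 | exists v l y s,
     [/\ v \in refls ^+ l, l.+2 <= k, v p = p, p.1 != y.1 & w = v * dg p y s]].
Proof.
elim: k w => [|k IH] w.
  by move=> h; move: (h); rewrite expg0 => /set1gP w1; constructor 1; exists 0; rewrite // w1 perm1.
rewrite expgS => /mulsgP[t w0 tT /IH h ->].
have tl v l : v \in refls ^+ l -> t * v \in refls ^+ l.+1.
  by move=> vl; rewrite expgS mem_mulg.
have [tp|tp] := eqVneq (t p) p.
  case: h => [[l lk [w0l w0p]]|[v [l [y [vl lk vp py ->]]]]|[v [l [y [s [vl lk vp py ->]]]]]].
  - by constructor 1; exists l.+1; rewrite // tl // permM tp.
  - by constructor 2; exists (t * v), l.+1, y; rewrite tl // permM tp mulgA.
  - by constructor 3; exists (t * v), l.+1, y, s; rewrite tl // permM tp mulgA.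
have [py0 tE] := refls_move tT tp.
(* As [v] fixes [p], conjugation by [v] keeps [p] as one end of the reflection. *)
have tv v l : v \in refls ^+ l -> v p = p ->
    exists2 y, p.1 != y.1 & t * v = v * refl p y.
  move=> /words_equivariant ev vp; exists (v (t p)).
    by rewrite -[in p.1]vp equivariant_line.
  by have := reflJ ev py0; rewrite vp -tE => <-; rewrite conjgE !mulgA mulgV mul1g.
case: h => [[l lk [w0l w0p]]|[v [l [y [vl lk vp py ->]]]]|[v [l [y [s [vl lk vp py ->]]]]]].
- have [y py ->] := tv _ _ w0l w0p.
  by constructor 2; exists w0, l, y.
- have [y1 py1 e] := tv _ _ vl vp; rewrite mulgA e -mulgA.
  (* Two factors at [p]: to the same line they form a [dg], to different lines [refl_swap] leaves
     only one of them at [p]. *)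
  have [/same_line[c yc]|y1y] := eqVneq y1.1 y.1.
    constructor 3; exists v, l, y1, (- c)%R; rewrite dgE // opprK yc.
    by split.
  constructor 2; exists (v * refl y1 y), l.+1, y1; split=> //; first exact: (words1 y1y vl).
    by rewrite permM vp refl_out.
  by rewrite refl_swap // mulgA.
have [y1 py1 e] := tv _ _ vl vp; rewrite mulgA e -mulgA.
(* Three factors at [p]: to one line they collapse to a single reflection; otherwise both factors of
   the [dg] are swapped past the new one. *)
have [/esym/same_line[c yc]|y1y] := eqVneq y1.1 y.1.
  constructor 2; exists v, l, (shift (c - s)%R y); split=> //; first by lia.
  congr (_ * _); apply: equivariant_ext.
  - by apply: equivariantM; [apply: refl_equivariant|apply: dg_equivariant].
  - exact: refl_equivariant.
  move=> i; have [->|nx] := eqVneq i p.1.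
    exists p => //; rewrite permM !refl_l yc dg_equivariant dg_r // shiftD.
    by rewrite addrC.
  have [->|ny] := eqVneq i y.1.
    exists y => //; rewrite permM yc !refl_shift_r // !refl_r //.
    by rewrite dg_equivariant dg_l shiftD opprB addrC.
  by exists (i, 0%R); rewrite // permM yc (refl_out (y := shift c y)) // dg_out // refl_out.
constructor 2; exists (v * refl y1 y * refl y1 (shift (- s)%R y)), l.+2, y1; split=> //.
- by do 2 apply: words1 => //.
- by rewrite !permM vp !refl_out.
rewrite dgE // [refl p y1 * (_ * _)]mulgA refl_swap // -[_ * refl p y1 * _]mulgA.
by rewrite (refl_swap (y := shift _ _)) // !mulgA.
Qed.

(** Of the three normal forms of [w * refl p y], the first fixes [p] and the third keeps its line.
    So the second holds, with [z = y], and cancelling the reflection writes [w] with one factor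
    less. *)
Lemma len_mul_refl_fixed w p y : w \in W -> w p = p -> p.1 != y.1 ->
  len (w * refl p y) = (len w).+1.
Proof.
move=> wW wp py; have tW := refl_W py.
apply/eqP; rewrite eqn_leq -{1}addn1 -(len_refl py) lenM //=.
have q : (w * refl p y) p = y by rewrite permM wp refl_l.
have /(factor_moving_point p) := len_word (groupM wW tW).
case=> [[l lk [wl]]|[v [l [z [vl lk vp pz e]]]]|[v [l [z [s [vl lk vp pz e]]]]]].
- by rewrite q => yp; rewrite -yp eqxx in py.
- have yz : y = z by rewrite -q e permM vp refl_l.
  apply: leq_trans lk; rewrite ltnS; apply: len_min.
  have /mulIg -> : w * refl p y = v * refl p y by rewrite e yz.
  by [].
- by move: q; rewrite e permM vp dg_l => yp; rewrite -yp eqxx in py.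
Qed.

Lemma len_mul_refl_moved w p : w \in W -> p.1 != (w p).1 ->
  len w = (len (w * refl p (w p))).+1.
Proof.
move=> wW pw; set t := refl p (w p).
have e : w = w * t * t by rewrite -mulgA reflK // mulg1.
by rewrite {1}e len_mul_refl_fixed ?groupM ?refl_W // permM refl_r.
Qed.

Lemma shorten_moved w p : w \in W -> w p != p ->
  exists2 y, p.1 != y.1 & len (w * refl p y) < len w.
Proof.
move=> wW wp; have /(factor_moving_point p) := len_word wW.
case=> [[l lk [_ e]]|[v [l [z [vl lk vp pz e]]]]|[v [l [z [s [vl lk vp pz e]]]]]].
- by rewrite e eqxx in wp.
- exists z => //; rewrite {1}e -mulgA reflK // mulg1.
  by apply: leq_trans lk; rewrite ltnS; apply: len_min.
exists (shift (- s)%R z) => //; rewrite {1}e dgE // -!mulgA reflK // mulg1.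
apply: leq_trans lk; rewrite ltnS; apply: len_min.
exact: words1.
Qed.

(** Only the third normal form turns [p], so a shortest word yields a diagonal factor of length
    two. *)
Lemma len_shift w p s : w \in W -> s != 0%R -> w p = shift s p ->
  exists v y, [/\ v \in W, v p = p, p.1 != y.1, w = v * dg p y s & len w = (len v).+2].
Proof.
move=> wW s0 wp; have /(factor_moving_point p) := len_word wW.
case=> [[l lk [_ e]]|[v [l [z [vl lk vp pz e]]]]|[v [l [z [s' [vl lk vp pz e]]]]]].
- by move/eqP: e; rewrite wp shift_id (negPf s0).
- have zw : z = w p by rewrite e permM vp refl_l.
  by move: pz; rewrite zw wp eqxx.
have ss : s' = s.
  by apply/eqP; rewrite -(shift_eq p) -wp e permM vp dg_l.
rewrite {}ss in e; have vW := words_W vl.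
exists v, z; split=> //; apply/eqP; rewrite eqn_leq; apply/andP; split.
  rewrite {1}e -addn2; apply: leq_trans (lenM vW (dg_W _ pz)) _.
  by rewrite leq_add2l len_dg.
by apply: leq_trans lk; rewrite !ltnS; apply: len_min.
Qed.

(** If [u] moved [p], some reflection at [p] would shorten [u] and hence not lengthen [w = a * u],
    against [len_mul_refl_fixed]. *)
Lemma le_fixed u w p : u \in W -> w \in W -> le u w -> w p = p -> u p = p.
Proof.
move=> uW wW uw wp; apply/eqP/negPn/negP=> /(shorten_moved uW)[y py lt].
have [a aW [e1 e2]] := leP' uW wW uw.
have := len_mul_refl_fixed wW wp py; rewrite e1 -mulgA -e1 => e3.
have := lenM aW (groupM uW (refl_W py)).
by rewrite e3 e2 [(len u + _)%N]addnC ltn_add2l ltnNge (ltnW lt).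
Qed.

End ColoredPermutations.

(** * Intervals of the absolute order and the image of a point *)

Section Intervals.
Import GroupScope GRing.Theory.
Variables (I : finType) (C : finZmodType).
Local Notation pt := (I * C)%type.
Local Notation W := (W I C).
Implicit Types (x y p q r m : pt) (s c : C) (u v w t : {perm pt}).

Lemma dgJ x y s w : equivariant w -> x.1 != y.1 -> dg x y s ^ w = dg (w x) (w y) s.
Proof. by move=> ew xy; rewrite /dg conjMg !reflJ // 1?eq_sym // ew. Qed.

Lemma dgC p m s : p.1 != m.1 -> dg p m s = dg m p (- s)%R.
Proof.
move=> pm; have mp : m.1 != p.1 by rewrite eq_sym.
apply: equivariant_ext; try exact: dg_equivariant.
move=> i; have [->|ip] := eqVneq i p.1; first by exists p; rewrite // dg_l dg_r // opprK.
have [->|im] := eqVneq i m.1; first by exists m; rewrite // dg_l dg_r.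
by exists (i, 0%R); rewrite // !dg_out.
Qed.

Lemma dg_shift_r p m s c : p.1 != m.1 -> dg p (shift c m) s = dg p m s.
Proof.
move=> pm; apply: equivariant_ext; try exact: dg_equivariant.
move=> i; have [->|ip] := eqVneq i p.1; first by exists p; rewrite // !dg_l.
have [->|im] := eqVneq i m.1; last by exists (i, 0%R); rewrite // !dg_out.
by exists (shift c m); rewrite // [RHS]dg_equivariant !dg_r // !shiftD addrC.
Qed.

Lemma len_dg2 p m s : p.1 != m.1 -> s != 0%R -> len (dg p m s) = 2%N.
Proof.
move=> pm s0; apply/eqP; rewrite eqn_leq len_dg //=.
have [v [y [_ _ _ _ ->]]] := len_shift (dg_W s pm) s0 (dg_l p m s).
by rewrite !ltnS.
Qed.

Lemma le_dg_fixed w p m s : w \in W -> p.1 != m.1 -> s != 0%R -> le (dg p m s) w ->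
  w p != p /\ w m != m.
Proof.
move=> wW pm s0 h; split; apply/eqP=> /(le_fixed (dg_W s pm) wW h)/eqP.
  by rewrite dg_l shift_id (negPf s0).
by rewrite dg_r // shift_id oppr_eq0 (negPf s0).
Qed.

(** If [w] turned only the line [i0], [len_shift] would split off a [dg] below [w] turning a second
    line, and [w] fixes that line. This is the trace, at the level of words, of the condition that
    the entries have product 1. *)
Lemma W_moves_two w i0 : w \in W -> (forall i, i != i0 -> w (i, 0%R) = (i, 0%R)) -> w = 1.
Proof.
move=> wW h; have ew := W_equivariant wW.
have : (w (i0, 0%R)).1 = i0.
  apply/eqP/negPn/negP=> h0; have /= := h _ h0.
  set j := (w (i0, _)).1 => /(congr1 fst)/= wj.
  have : ((w (i0, 0%R)).1 == (w (j, 0%R)).1) by rewrite wj.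
  by rewrite equivariant_line //= eq_sym (negPf h0).
case/esym/(same_line (x := (i0, 0%R)))=> c wi0.
have [c0|c0] := eqVneq c 0%R.
  apply: equivariant_ext => //; first exact: equivariant1.
  move=> i; exists (i, 0%R); rewrite // perm1; have [->|/h//] := eqVneq i i0.
  by rewrite wi0 c0 shift0.
have [v [y [vW vp py e l]]] := len_shift wW c0 wi0.
have dle : le (dg (i0, 0%R) y c) w.
  by apply: (leI' (z := v)); rewrite ?dg_W // l len_dg2.
have [_ /eqP[]] := le_dg_fixed wW py c0 dle.
have [d yd] := same_line (x := (y.1, 0%R)) (y := y) erefl.
by rewrite yd ew h // eq_sym.
Qed.

(** If [w = u * z] with [u p = p], then [z] sends [p] to [w p], so the reflection shortens [z] just
    as it shortens [w]. *)
Lemma le_fixing u w p : u \in W -> w \in W -> p.1 != (w p).1 ->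
  (le u w && (u p == p)) = le u (w * refl p (w p)).
Proof.
move=> uW wW pw; set t := refl p (w p); have tW : t \in W by apply: refl_W.
have lw : len w = (len (w * t)).+1 by apply: len_mul_refl_moved.
have wp : (w * t) p = p by rewrite permM refl_r.
apply/andP/idP=> [[/(leP uW wW)[z zW [e1 e2]] /eqP up]|h]; last first.
  split; last by apply/eqP/(le_fixed uW (groupM wW tW) h).
  apply: (le_trans (v := w * t)); rewrite ?groupM //.
  apply: (leI (z := t)); rewrite ?groupM //; first by rewrite -mulgA reflK // mulg1.
  by rewrite lw len_refl // addn1.
have zp : z p = w p by rewrite e1 permM up.
have lz : len z = (len (z * t)).+1 by rewrite /t -zp; apply: len_mul_refl_moved; rewrite ?zp.
apply: (leI (z := (z * t))); rewrite ?groupM //; first by rewrite e1 mulgA.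
by move: lw e2; rewrite lz; lia.
Qed.

(** Right multiplication by [refl p r] trades elements sending [p] to [r] for elements fixing [p].
    It shortens [u] by one, and the triangle inequality forces the same drop for [w]. *)
Lemma le_mul_refl u w p r : u \in W -> w \in W -> p.1 != r.1 ->
  (le u w && (u p == r)) =
  [&& len w == (len (w * refl p r)).+1, le (u * refl p r) (w * refl p r)
    & (u * refl p r) p == p].
Proof.
move=> uW wW pr; set t := refl p r; have tW : t \in W by apply: refl_W.
have tt : t * t = 1 by apply: reflK.
apply/andP/and3P=> [[/(leP' uW wW)[z zW [e1 e2]] /eqP up]|[/eqP lw h /eqP ut]].
  have lu : len u = (len (u * t)).+1.
    by rewrite /t -up; apply: len_mul_refl_moved; rewrite ?up.
  have le1 : len (w * t) <= len z + len (u * t).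
    by rewrite e1 -mulgA; apply: lenM; rewrite ?groupM.
  have le2 : len w <= len (w * t) + 1.
    rewrite -(len_refl pr) -{1}[w]mulg1 -tt mulgA.
    by apply: lenM; rewrite ?groupM.
  have lw : len w = (len (w * t)).+1 by lia.
  split; first exact/eqP.
    apply: (leI' (z := z)); rewrite ?groupM //; first by rewrite e1 mulgA.
    by move: e2 lw; rewrite lu; lia.
  by rewrite permM up refl_r.
have ue : u = u * t * t by rewrite -mulgA tt mulg1.
split; last by rewrite ue permM ut refl_l.
have utW : u * t \in W by rewrite groupM.
have wtW : w * t \in W by rewrite groupM.
have [z zW [e1 e2]] := leP' utW wtW h.
apply: (leI' (z := z)) => //; first by rewrite {1}ue mulgA -e1 -mulgA tt mulg1.
by rewrite {1}ue len_mul_refl_fixed // lw e2; lia.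
Qed.

Definition NC w : {set {perm pt}} := [set x in W | le x w].

End Intervals.

(** * Which lines an element below a Coxeter element can turn *)

Section CoxeterElement.
Import GroupScope GRing.Theory.
Variables (I : finType) (C : finZmodType).
Local Notation pt := (I * C)%type.
Local Notation W := (W I C).
Implicit Types (x y p q r m : pt) (s c : C) (u v w t : {perm pt}) (A S : {set I}).
Variables (n : I) (a : C).
Hypothesis a0 : a != 0%R.
Local Notation nu := (n, 0%R : C).

(* The case [S = ~: [set n]] is that of a Coxeter element; smaller [S] arise by
   multiplying with reflections below it. *)
Definition one_cycle S w :=
  [/\ n \notin S, w nu = shift (- a)%R nu,
      forall i, i \notin S -> i != n -> w (i, 0%R) = (i, 0%R)
    & forall A, A \subset S -> A != set0 ->
        (forall i, i \in A -> (w (i, 0%R)).1 \in A) -> A = S].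

(** Multiplying by this reflection bypasses [k]: its predecessor in the cycle is sent to its
    successor. *)
Lemma one_cycle_contract S w k : w \in W -> one_cycle S w -> k \in S ->
  (w (k, 0%R)).1 != k ->
  one_cycle (S :\ k) (w * refl (k, 0%R) (w (k, 0%R))).
Proof.
move=> wW [nS wn wfix wcyc] kS wk; have ew := W_equivariant wW.
set t := refl _ _.
have kn : k != n by apply: contraNneq nS => <-.
have wkn : (w (k, 0%R)).1 != n.
  have := equivariant_line (k, 0%R) nu ew.
  by rewrite wn /= (negPf kn) => ->.
split.
- by rewrite !inE negb_and nS orbT.
- by rewrite permM wn refl_out // eq_sym.
- move=> i; rewrite !inE negb_and negbK; have [-> _ _|ik /= iS iN] := eqVneq i k.
    by rewrite permM refl_r // eq_sym.
  rewrite permM wfix // refl_out //= -{1}[i]/((i, 0%R : C).1) -(wfix i iS iN).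
  by rewrite equivariant_line.
move=> A AS A0 Ast.
have kA : k \notin A by apply/negP=> /(subsetP AS); rewrite !inE eqxx.
have wA x : x.1 \in A -> (w x).1 != k -> (w x).1 \in A.
  case: x => i c /= iA wi.
  have wic : (w (i, c)).1 = (w (i, 0%R)).1.
    by apply/eqP; rewrite equivariant_line.
  have := Ast i iA; rewrite permM refl_out -?wic //.
  rewrite equivariant_line //=; by apply: contraNneq kA => <-.
(* If [A] contains the predecessor of [k], then [k] is put back to get a set stable under [w]. *)
pose B := if [exists j in A, (w (j, 0%R)).1 == k] then k |: A else A.
have BS : B = S.
  apply: wcyc.
  - rewrite /B; case: ifP => _; rewrite ?subUset ?sub1set ?kS /=;
    exact: subset_trans AS (subsetDl _ _).
  - rewrite /B; case: ifP => _ //; by apply/set0Pn; exists k; rewrite setU11.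
  rewrite /B => i; case: ifP => [/exists_inP[j jA /eqP wj]|/exists_inPn h].
    rewrite inE => /orP[/set1P->|iA]; last first.
      by rewrite inE; have [->|h] := eqVneq (w (i, 0%R)).1 k; rewrite ?set11 // wA ?orbT.
    rewrite inE; apply/orP; right; have := Ast j jA; rewrite permM.
    have [c ->] := same_line (x := (k, 0%R)) (y := w (j, 0%R)) (esym wj).
    by rewrite refl_equivariant refl_l.
  by move=> iA; apply: wA => //; apply: h.
move: BS; rewrite /B; case: ifP => _ BS; first by rewrite -BS setU1K.
by move: kA; rewrite BS kS.
Qed.

Lemma dg_unique w p : w \in W -> p.1 != n -> w nu = shift (- a)%R nu ->
  (forall i, i != p.1 -> i != n -> w (i, 0%R) = (i, 0%R)) -> w = dg p nu a.
Proof.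
move=> wW pn wn h; apply/eqP; rewrite eq_mulgV1; apply/eqP/(W_moves_two (i0 := p.1)).
  by rewrite groupM // groupV dg_W.
move=> i ip; rewrite permM; apply: (@perm_inj _ (dg p nu a)); rewrite permKV.
have [->|iN] := eqVneq i n; first by rewrite wn dg_r.
by rewrite h // dg_out.
Qed.

(** Lines of [S] other than those of [p] and [m] are contracted away, which keeps [dg p m s] below
    by [le_fixing]. There remains either a [dg] at [nu], comparable only to itself among elements of
    length 2, or a cycle through the lines of [p] and [m]. *)
Lemma dg_le_one_cycle S w p m s : w \in W -> one_cycle S w -> p.1 != m.1 ->
  s != 0%R -> le (dg p m s) w -> (m.1 = n /\ s = a) \/ (p.1 = n /\ s = - a)%R.
Proof.
elim: {S}#|S| {-2}S (eqxx #|S|) w => [|k IH] S.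
  rewrite cards_eq0 => /eqP-> w wW [_ wn wfix _] pm s0 dw.
  case/eqP: a0; apply: (@oppr_inj C); rewrite oppr0; apply/eqP.
  rewrite -(shift_eq nu) -wn shift0 (W_moves_two (i0 := n) wW) ?perm1 //.
  by move=> i; apply: wfix; rewrite inE.
move=> cS w wW wS pm s0 dw; have [nS wn wfix wcyc] := wS.
have ew := W_equivariant wW.
have moved x : w x != x -> x.1 \in S \/ x.1 = n.
  move=> wx; have [|xS] := boolP (x.1 \in S); first by left.
  have [|xn] := eqVneq x.1 n; first by right.
  have [c xc] := same_line (x := (x.1, 0%R)) (y := x) erefl.
  by move: wx; rewrite xc ew wfix // eqxx.
have [/moved pS /moved mS] := le_dg_fixed wW pm s0 dw.
have off i j : i \in S -> j \in S -> i != j -> (w (i, 0%R)).1 != i.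
  move=> iS jS ij; apply: contraNneq ij => wi.
  have e : [set i] = S.
    apply: wcyc; rewrite ?sub1set //; first by apply/set0Pn; exists i; rewrite set11.
    by move=> l /set1P ->; rewrite wi set11.
  by move: jS; rewrite -e => /set1P->.
have [/existsP[i /and3P[iS ip im]]|/existsPn none] :=
  boolP [exists i, [&& i \in S, i != p.1 & i != m.1]].
  have wi : (w (i, 0%R)).1 != i.
    case: pS => [pS|pn]; first by apply: off pS _.
    case: mS => [mS|mn]; first by apply: off mS _.
    by move: pm; rewrite pn mn eqxx.
  apply: (IH (S :\ i) _ (w * refl (i, 0%R) (w (i, 0%R)))) => //.
  - by move: cS; rewrite (cardsD1 i) iS add1n eqSS.
  - by rewrite groupM // refl_W // eq_sym.
  - exact: one_cycle_contract.
  have iw : ((i, 0%R) : pt).1 != (w (i, 0%R)).1 by rewrite eq_sym.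
  by rewrite -(le_fixing (dg_W s pm) wW iw) dw dg_out /=.
have wfix' i : i != p.1 -> i != m.1 -> i != n -> w (i, 0%R) = (i, 0%R).
  by move=> ip im iN; apply: wfix => //; have := none i; rewrite ip im !andbT.
have eq_dg q b : q.1 != n -> b != 0%R -> le (dg q nu b) (dg q nu a) -> b = a.
  move=> qn b0 h.
  have e : dg q nu b = dg q nu a by apply: le_len_eq; rewrite ?dg_W // !len_dg2.
  by apply/eqP; rewrite -(shift_eq q) -(dg_l q nu) e dg_l.
have nuE q : q.1 = n -> exists c, q = shift c nu.
  by move=> qn; apply: same_line.
case: mS => [mS|mn]; last first.
  have pn : p.1 != n by rewrite -mn.
  left; split=> //; apply: (eq_dg p) => //; rewrite -(dg_unique wW pn wn).
    by have [c mc] := nuE m mn; rewrite -(dg_shift_r _ c) // -mc.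
  by move=> i ip iN; apply: wfix'; rewrite ?mn.
have mn : m.1 != n by apply: contraNneq nS => <-.
case: pS => [pS|pn]; last first.
  right; split=> //; apply: (@oppr_inj C); rewrite opprK; apply: (eq_dg m) => //.
    by rewrite oppr_eq0.
  rewrite -(dg_unique wW mn wn).
    have [c pc] := nuE p pn; rewrite -(dg_shift_r _ c) // -pc -(dgC s pm) //.
  by move=> i im iN; apply: wfix'; rewrite ?pn.
(* Both lines lie in [S]. Then [w] has length 3, and its complement to [dg p m s] has length at most
   1 but still turns [nu], which no reflection does. *)
exfalso.
have pn : p.1 != n by apply: contraNneq nS => <-.
have pl : ((p.1, 0%R) : pt).1 != (w (p.1, 0%R)).1.
  by rewrite eq_sym; apply: off mS _.
have lw := len_mul_refl_moved wW pl.
set t := refl _ _ in lw; have tW : t \in W by apply: refl_W.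
have wtW : w * t \in W by rewrite groupM.
have [_ wtn wtfix _] : one_cycle (S :\ p.1) (w * t).
  by apply: one_cycle_contract; rewrite // eq_sym.
have e : w * t = dg m nu a.
  apply: dg_unique => // i im iN; apply: wtfix => //.
  by rewrite !inE; have := none i; case: eqP => //= _; rewrite im andbT.
have [z zW [e1 e2]] := leP (dg_W s pm) wW dw.
have zn : z nu = shift (- a)%R nu.
  by rewrite -wn e1 permM dg_out // eq_sym.
have lw3 : len w = 3%N by rewrite lw e len_dg2.
have zle : len z <= 1 by rewrite -(leq_add2l 2) -(len_dg2 pm s0) -e2 lw3 len_dg2.
have [c0|zz] : z = 1 \/ z \in refls I C.
  have := len_word zW; case: (len z) zle => [|[|//]] _.
    by rewrite expg0 => /set1gP ->; left.
  by rewrite expg1; right.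
  by move: zn; rewrite c0 perm1 => /esym/eqP; rewrite shift_id oppr_eq0 (negPf a0).
have zm : z nu != nu by rewrite zn shift_id oppr_eq0.
by have [] := refls_move zz zm; rewrite zn eqxx.
Qed.

Variable g : {perm pt}.
Hypothesis gW : g \in W.
Hypothesis g_cycle : one_cycle (~: [set n]) g.

Lemma dg_le p m s : p.1 != m.1 -> s != 0%R -> le (dg p m s) g ->
  (m.1 = n /\ s = a) \/ (p.1 = n /\ s = - a)%R.
Proof. exact: dg_le_one_cycle gW g_cycle. Qed.

Lemma shift_center (x : {perm pt}) s : x \in W -> le x g -> s != 0%R -> x nu = shift s nu -> s = (- a)%R.
Proof.
move=> xW xg s0 /(len_shift xW s0)[v [y [vW vn ny xE l]]].
have dx : le (dg nu y s) x by apply: (leI' (z := v)); rewrite ?dg_W // l len_dg2 // addnC addn2.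
have [[yn _]|[_ //]] := dg_le ny s0 (le_trans (dg_W s ny) xW gW dx xg).
by rewrite -yn eqxx in ny.
Qed.

(* A non-central line can be turned only by [a], and then the centre is turned by [- a]. *)
Lemma shift_noncentral (x : {perm pt}) p s : x \in W -> le x g -> p.1 != n -> s != 0%R ->
  x p = shift s p ->
  s = a /\ exists v, [/\ v \in W, x = v * dg p nu a, len x = (len v).+2, v p = p & v nu = nu].
Proof.
move=> xW xg pn s0 /(len_shift xW s0)[v [y [vW vp py xE l]]].
have dW := dg_W s py.
have dx : le (dg p y s) x by apply: (leI' (z := v)); rewrite // l len_dg2 // addnC addn2.
have [[yn sa]|[pn' _]] := dg_le py s0 (le_trans dW xW gW dx xg); last first.
  by rewrite pn' eqxx in pn.
rewrite {s}sa in xE l dW dx s0 *.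
have [c yc] : exists c, y = shift c nu by apply: same_line.
have eE : dg p y a = dg p nu a by rewrite yc dg_shift_r.
rewrite {}eE in xE dW dx; split=> //; exists v; split=> //.
(* What remains is that [v] fixes [nu]; otherwise it turns [nu] or moves it to another line. *)
apply/eqP/negPn/negP=> vn.
have vx : le v x by apply: (leI (z := dg p nu a)); rewrite // l len_dg2 // addn2.
have vg : le v g by apply: le_trans vx xg.
have ev := W_equivariant vW.
have [/esym/(same_line (x := nu))[s' vs']|vnl] := eqVneq (v nu).1 n.
  have s'0 : s' != 0%R by move: vn; rewrite vs' shift_id.
  have s'a := shift_center vW vg s'0 vs'.
  have [v' [y' [v'W v'n ny' vE l']]] := len_shift vW s'0 vs'.
  have d'W := dg_W s' ny'.
  have d'v : le (dg nu y' s') v by apply: (leI' (z := v')); rewrite // l' len_dg2 // addnC addn2.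
  have [_ vy'] := le_dg_fixed vW ny' s'0 d'v.
  have y'p : y'.1 != p.1.
    by apply: contraNneq vy' => /esym/same_line[c' ->]; rewrite ev vp.
  (* The two diagonal factors meeting at [nu] combine to an element below [g] of length at least
     4. *)
  set D := dg nu y' s' * dg p nu a.
  have DW : D \in W by rewrite groupM.
  have xD : x = v' * D by rewrite xE vE -mulgA.
  have lD : 4 <= len D by have := lenM v'W DW; rewrite -xD l l' -addn4 leq_add2l.
  have Dg : le D g.
    apply: le_trans xg => //; apply: (leI' (z := v')); rewrite // l l'.
    rewrite addnC -addn4 leq_add2l; have := lenM d'W dW; rewrite !len_dg2 //.
  have Dn : D nu = shift (s' - a)%R nu.
    by rewrite permM dg_l dg_equivariant dg_r // shiftD addrC.
  (* If [D] turns [nu], it does so by [- a], whence [s' = 0]; if it does not, [D] is a single [dg]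
     and has length 2. Both are absurd. *)
  have [sa0|sa0] := eqVneq (s' - a)%R 0%R; last first.
    have := shift_center DW Dg sa0 Dn => /eqP; rewrite -subr_eq0 opprK subrK.
    by rewrite (negPf s'0).
  suff DE : D = dg p y' a by move: lD; rewrite DE len_dg2 // eq_sym.
  apply: equivariant_ext; try exact: W_equivariant; try exact: dg_equivariant.
  have sa : s' = a by apply/eqP; rewrite -subr_eq0 sa0.
  move=> i; have [->|inn] := eqVneq i n.
    by exists nu; rewrite // Dn sa0 shift0 dg_out // eq_sym.
  have [->|iy] := eqVneq i y'.1.
    exists y'; rewrite // permM dg_r // dg_equivariant dg_out //; last by rewrite eq_sym.
    by rewrite dg_r 1?eq_sym // sa.
  have [->|ip] := eqVneq i p.1.
    by exists p; rewrite // permM [dg nu _ _ p]dg_out ?dg_l // eq_sym.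
  by exists (i, 0%R); rewrite // permM !dg_out.
have vnl' : nu.1 != (v nu).1 by rewrite eq_sym.
have bW := refl_W vnl'; set b := refl _ _ in bW.
have lv := len_mul_refl_moved vW vnl'; rewrite -/b in lv.
have vbW : v * b \in W by rewrite groupM.
have xb : x = v * b * (b * dg p nu a) by rewrite -!mulgA [b * (b * _)]mulgA reflK // mul1g.
have pq : p.1 != (v nu).1 by rewrite -{1}vp equivariant_line.
(* Conjugation by [b] moves one line of the [dg] from [nu] to [v nu], which puts below [g] a
   diagonal element with no central line. *)
have eb : b * dg p nu a = dg p (v nu) a * b.
  have := dgJ a (@refl_equivariant _ _ nu (v nu)) (pn : p.1 != nu.1).
  rewrite refl_out // refl_l => <-; rewrite conjgE -/b (reflV vnl') -/b.
  by rewrite -!mulgA reflK // mulg1.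
have lbd : 3 <= len (b * dg p nu a).
  by have := lenM vbW (groupM bW dW); rewrite -xb l lv -addn3 leq_add2l.
have hg : le (b * dg p nu a) g.
  have bdW : b * dg p nu a \in W by rewrite groupM.
  apply: (le_trans bdW xW gW _ xg); apply: (leI' bdW vbW xb).
  have := lenM bW dW; rewrite len_dg2 // len_refl // => h3.
  by rewrite l lv addnC -addn3 leq_add2l.
have hd : le (dg p (v nu) a) g.
  have bdW : b * dg p nu a \in W by rewrite groupM.
  apply: (le_trans (dg_W a pq) bdW gW _ hg); apply: (leI (dg_W a pq) bW eb).
  by rewrite len_dg2 // len_refl.
have [[vn' _]|[pn' _]] := dg_le pq a0 hd.
  by rewrite vn' eqxx in vnl.
by rewrite pn' eqxx in pn.
Qed.

(** * Tilings of the intervals below a Coxeter element *)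

Local Notation tile N X := (tiled (sym_boolean (@le I C) (@len I C) N) X).

Lemma le_mulr u v t : u \in W -> v \in W -> t \in W ->
  len (u * t) = (len u).+1 -> len (v * t) = (len v).+1 -> le (u * t) (v * t) = le u v.
Proof.
move=> uW vW tW lu lv; rewrite /le lu lv addSn eqSS; congr (_ == (_ + _)%N).
rewrite invMg -(lenJ (v := u^-1 * v) _ tW) ?groupM ?groupV //.
by rewrite conjgE !mulgA.
Qed.

Lemma tile_rcoset N (X : {set {perm pt}}) t : t \in W -> X \subset W ->
  {in X, forall x : {perm pt}, len (x * t) = (len x).+1} -> tile N X -> tile N.+2 (X :* t).
Proof.
move=> tW /subsetP XW h; rewrite -addn2 -[2]/(1 + 1)%N addnA -rcosetE.
apply: tiled_boolean_map => [x y _ _ /mulIg|x y xX yX|x xX] //.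
  exact: le_mulr (XW _ xX) (XW _ yX) tW (h _ xX) (h _ yX).
by rewrite h ?addn1.
Qed.

Lemma tile_doubling N (X : {set {perm pt}}) p y : p.1 != y.1 -> X \subset W ->
  {in X, forall x : {perm pt}, x p = p} -> tile N X -> tile N.+1 (X :|: X :* refl p y).
Proof.
move=> py /subsetP XW Xp; have tW := refl_W py; rewrite -rcosetE.
have lX (x : {perm pt}) : x \in X -> len (x * refl p y) = (len x).+1.
  by move=> xX; apply: len_mul_refl_fixed; rewrite ?XW ?Xp.
apply: tiled_double => [x|x z _ _ /mulIg|x z xX zX|x z xX zX|x z xX zX|x xX] //.
- exact: le_refl.
- exact: le_mulr (XW _ xX) (XW _ zX) tW (lX _ xX) (lX _ zX).
(* [x^-1 * z] fixes [p] as well, so the reflection lengthens it by one. *)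
- rewrite /le lX // mulgA len_mul_refl_fixed ?(groupM (groupVr (XW _ xX)) (XW _ zX)) //; first by rewrite addnS eqSS.
  by rewrite permM -{1}(Xp _ xX) permK Xp.
- apply/negP=> /(le_fixed (groupM (XW _ xX) tW) (XW _ zX)) /(_ (Xp _ zX)).
  by rewrite permM Xp // refl_l => yp; rewrite -yp eqxx in py.
exact: lX.
Qed.

Lemma NC_P w (x : {perm pt}) : reflect (x \in W /\ le x w) (x \in NC w).
Proof. by rewrite inE; apply: andP. Qed.

Lemma NC_W w : NC w \subset W.
Proof. by apply/subsetP=> x /NC_P[]. Qed.

Lemma NC_fiber_fixed w p : w \in W -> p.1 != (w p).1 ->
  [set x in NC w | x p == p] = NC (w * refl p (w p)).
Proof.
move=> wW pw; apply/setP=> x; rewrite !inE -andbA.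
by have [xW|//] := boolP (x \in W); rewrite /= le_fixing.
Qed.

Lemma NC_fiber w p r : w \in W -> p.1 != (w p).1 -> r.1 != p.1 -> r.1 != (w p).1 ->
  len w = (len (w * refl p r)).+1 ->
  [set x in NC w | x p == r] = NC (w * refl p r * refl p (w p)) :* refl p r.
Proof.
move=> wW pw rp rq lw; have pr : p.1 != r.1 by rewrite eq_sym.
have tW := refl_W pr; have qE : (w * refl p r) p = w p by rewrite permM refl_out // eq_sym.
apply/setP=> x; rewrite mem_rcoset reflV // !inE -andbA groupMr //.
have [xW|//] := boolP (x \in W); rewrite /= le_mul_refl // lw eqxx /=.
have := le_fixing (groupM xW tW) (groupM wW tW) (_ : p.1 != ((w * refl p r) p).1).
by rewrite qE; apply.
Qed.

Lemma NC_fiber_top w p : w \in W -> p.1 != (w p).1 ->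
  [set x in NC w | x p == w p] = NC (w * refl p (w p)) :* refl p (w p).
Proof.
move=> wW pw; have tW := refl_W pw; have lw := len_mul_refl_moved wW pw.
apply/setP=> x; rewrite mem_rcoset reflV // !inE -andbA groupMr //.
have [xW|//] := boolP (x \in W); rewrite /= le_mul_refl // lw eqxx /=.
apply/andb_idr=> h; apply/eqP/(le_fixed _ _ h); rewrite ?groupM //.
by rewrite permM refl_r.
Qed.

Lemma NC_fiber_empty w p r : w \in W -> p.1 != r.1 ->
  len w != (len (w * refl p r)).+1 -> [set x in NC w | x p == r] = set0.
Proof.
move=> wW pr lw; apply/setP=> x; rewrite !inE -andbA.
by have [xW|//] := boolP (x \in W); rewrite /= le_mul_refl // (negPf lw).
Qed.

Lemma le_mul_refl_self w p r : w \in W -> p.1 != r.1 ->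
  len w = (len (w * refl p r)).+1 -> le (w * refl p r) w.
Proof.
move=> wW pr lw; have tW := refl_W pr.
apply: (leI (z := refl p r)); rewrite ?groupM // ?lw ?len_refl ?addn1 //.
by rewrite -mulgA reflK // mulg1.
Qed.

Lemma tile_off_lines w p (S : {set pt}) : w \in W -> le w g -> p.1 != (w p).1 ->
  {in S, forall r, r.1 != p.1 /\ r.1 != (w p).1} ->
  (forall v, v \in W -> le v g -> len v < len w -> tile (len v) (NC v)) ->
  tile (len w) [set x in NC w | x p \in S].
Proof.
move=> wW wg pw hS IH.
apply: (tiled_fibers (f := fun x : {perm pt} => x p)) => r /hS[rp rq].
have pr : p.1 != r.1 by rewrite eq_sym.
have [/eqP lw|lw] := boolP (len w == (len (w * refl p r)).+1); last first.
  by rewrite NC_fiber_empty //; apply: tiled0.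
rewrite NC_fiber //; set t := refl p r in lw *.
have tW : t \in W by apply: refl_W.
have qE : (w * t) p = w p by rewrite permM refl_out // eq_sym.
have cW : w * t \in W by rewrite groupM.
have uW := refl_W pw.
have pc : p.1 != ((w * t) p).1 by rewrite qE.
have lc := len_mul_refl_moved cW pc; rewrite qE in lc.
have l2 : len w = (len (w * t * refl p (w p))).+2 by rewrite lw lc.
rewrite l2; apply: tile_rcoset => //; first exact: NC_W.
  move=> x /NC_P[xW xc]; apply: len_mul_refl_fixed => //.
  apply: le_fixed xc _; rewrite ?groupM //.
  by rewrite permM qE refl_r.
apply: IH; rewrite ?groupM //; last by rewrite l2.
apply: (le_trans (v := w)) => //; rewrite ?groupM //.
apply: (le_trans (v := w * t)); rewrite ?groupM //; last exact: le_mul_refl_self.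
by apply: le_mul_refl_self => //; rewrite -lc.
Qed.

Lemma tile_on_pivot w p : w \in W -> le w g -> p.1 != (w p).1 ->
  (forall v, v \in W -> le v g -> len v < len w -> tile (len v) (NC v)) ->
  tile (len w) [set x in NC w | x p \in [set p; w p]].
Proof.
move=> wW wg pw IH; have tW := refl_W pw; have lw := len_mul_refl_moved wW pw.
have -> : [set x in NC w | x p \in [set p; w p]] =
          [set x in NC w | x p == p] :|: [set x in NC w | x p == w p].
  by apply/setP=> x; rewrite !inE andb_orr.
rewrite NC_fiber_top // NC_fiber_fixed // lw.
apply: tile_doubling => //; first exact: NC_W.
  move=> x /NC_P[xW xw]; apply: le_fixed xw _; rewrite ?groupM //.
  by rewrite permM refl_r.
apply: IH; rewrite ?groupM //; last by rewrite -lw.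
by apply: (le_trans (v := w)); rewrite ?groupM //; apply: le_mul_refl_self.
Qed.

(** One condition covers both kinds of turned fibers: if [x] turns [p] by [s], its complement in [w]
    sends [p] to [shift (- s) (w p)], and the same reflection shortens it. *)
Lemma special_fiber w p (x : {perm pt}) s : w \in W -> p.1 != (w p).1 -> s != 0%R ->
  x \in NC w -> x p = shift s p \/ x p = shift (- s)%R (w p) ->
  len w = (len (w * refl p (shift (- s)%R (w p)))).+1.
Proof.
move=> wW pw s0 /NC_P[xW xw]; have pr : p.1 != (shift (- s)%R (w p)).1 by [].
have tW := refl_W pr.
case=> xp; last first.
  have := le_mul_refl xW wW pr; rewrite xw xp eqxx /=.
  by case/esym/and3P=> /eqP.
have [z zW [e1 e2]] := leP xW wW xw.
have zp : z p = shift (- s)%R (w p).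
  rewrite e1 permM xp (W_equivariant zW) shiftD subrr shift0 //.
have lz := len_mul_refl_moved zW (_ : p.1 != (z p).1); rewrite zp in lz.
have {}lz := lz pr.
apply/eqP; rewrite eqn_leq; apply/andP; split.
  rewrite -{1}[w]mulg1 -(reflK pr) mulgA -addn1 -(len_refl pr).
  by apply: lenM; rewrite ?groupM.
rewrite e2 lz addnS ltnS {1}e1 -mulgA; apply: lenM; rewrite ?groupM //.
Qed.

Lemma tile_single (x : {perm pt}) : tile (len x + len x) [set x].
Proof.
apply: tiled1; exists void, (fun _ => x), (len x).
have e (A : {set void}) : A = set0 by apply/setP=> -[].
split=> [|A B|A|]; last by rewrite card_void addn0.
- apply/setP=> y; rewrite inE; apply/imsetP/eqP=> [[A _ ->//]|->].
  by exists set0; rewrite ?inE.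
- by rewrite [A]e sub0set le_refl.
- by rewrite [A]e cards0 addn0.
Qed.

Lemma NC1 : NC (1 : {perm pt}) = [set 1].
Proof.
apply/setP=> x; apply/NC_P/set1P=> [[xW /le_len]|->].
  by rewrite len1 leqn0 => /eqP /(len_eq0 xW).
by rewrite group1 le_refl.
Qed.

(** An element below the [dg] that leaves the line of [p] sends it to the central one. Undoing this
    by a reflection leaves an element that moves at most one line, hence the identity. *)
Lemma NC_dg p : p.1 != n -> le (dg p nu a) g ->
  NC (dg p nu a) = [set 1; dg p nu a] :|: [set refl p (shift c nu) | c : C].
Proof.
move=> pn eg; have pnu c : p.1 != (shift c nu).1 by [].
have eW := dg_W a (pn : p.1 != nu.1); set e := dg p nu a in eg eW *.
apply/setP=> x; apply/NC_P/idP=> [[xW xe]|]; last first.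
  rewrite !inE -orbA => /or3P[/eqP->|/eqP->|/imsetP[c _ ->]].
  - by rewrite group1 le1.
  - by rewrite le_refl.
  rewrite refl_W //; split=> //.
  have pc' : p.1 != (shift (- a)%R (shift c nu)).1 by [].
  apply: (leI (z := refl p (shift (- a)%R (shift c nu)))); rewrite ?refl_W //.
    by rewrite -dgE // dg_shift_r.
  by rewrite !len_refl // /e len_dg2.
have xg := le_trans xW eW gW xe eg; have ex := W_equivariant xW.
have xfix i : i != p.1 -> i != n -> x (i, 0%R) = (i, 0%R).
  by move=> ip iN; apply: le_fixed xe _; rewrite // dg_out.
have fix1 u : u \in W -> (forall i, i != n -> u (i, 0%R) = (i, 0%R)) -> u = 1.
  by move=> uW; apply: W_moves_two.
have [/same_line[s xs]|px] := eqVneq p.1 (x p).1.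
  have [s0|s0] := eqVneq s 0%R.
    rewrite (fix1 x xW) ?inE ?eqxx // => i iN; have [ip|/xfix->//] := eqVneq i p.1.
    have [c cE] := same_line (x := p) (y := (i, 0%R)) (esym ip).
    by rewrite cE ex xs s0 shift0.
  have [_ [v [vW xE l _ _]]] := shift_noncentral xW xg pn s0 xs.
  have := le_len xe; rewrite l len_dg2 // !ltnS leqn0 => /eqP/(len_eq0 vW) v1.
  by rewrite xE v1 mul1g !inE eqxx orbT.
have xn : (x p).1 = n.
  apply/eqP/negPn/negP=> xn.
  have [c cE] := same_line (x := ((x p).1, 0%R)) (y := x p) erefl.
  have : x (x p) = x p by rewrite {1}cE ex xfix // eq_sym.
  by move/perm_inj => xp; rewrite xp eqxx in px.
have [c xc] := same_line (x := nu) (y := x p) (esym xn).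
have tW := refl_W (pnu c); set t := refl p _ in tW.
have xtp : (x * t) p = p by rewrite permM xc refl_r.
have xt1 : x * t = 1.
  apply: fix1; rewrite ?groupM // => i iN; have [ip|ip] := eqVneq i p.1.
    have [c' ->] := same_line (x := p) (y := (i, 0%R)) (esym ip).
    by rewrite (W_equivariant (groupM xW tW)) xtp.
  by rewrite permM xfix // refl_out.
rewrite !inE; apply/orP; right; apply/imsetP; exists c => //.
by rewrite -[LHS]mulg1 -(reflK (pnu c)) mulgA xt1 mul1g.
Qed.

(** The bottom, the top and two atoms form a square; the other atoms have rank 1 and are centred
    singletons. *)
Lemma tile_dg p : p.1 != n -> le (dg p nu a) g -> tile 2 (NC (dg p nu a)).
Proof.
move=> pn eg; rewrite NC_dg //; have pnu c : p.1 != (shift c nu).1 by [].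
pose t c := refl p (shift c nu).
have tW c : t c \in W by apply: refl_W.
have lt c : len (t c) = 1%N by apply: len_refl.
have tI : injective t.
  move=> c c' /(congr1 (fun u : {perm pt} => u p)); rewrite !refl_l => /eqP.
  by rewrite shift_eq => /eqP.
(* The atoms of colours [0] and [- a] are the ones chosen for the square: their product is the top,
   and [a != 0] makes them distinct. *)
have eE : dg p nu a = t 0%R * t (- a)%R by rewrite dgE // /t shift0.
have le01 : len (t 0%R * t (- a)%R) = 2%N by rewrite -eE len_dg2.
have n1t c : t c != 1.
  by apply/eqP=> h; have := lt c; rewrite h len1.
have X1 : tile 1 [set 1; t 0%R].
  rewrite (_ : [set 1; t 0%R] = [set 1] :|: [set 1] :* t 0%R); last first.
    by rewrite -rcosetE /rcoset imset_set1 mul1g.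
  apply: tile_doubling; rewrite ?sub1set ?group1 //.
    by move=> x /set1P->; rewrite perm1.
  by have := tile_single 1; rewrite len1.
have X2 : tile 2 ([set 1; t 0%R] :|: [set x * t (- a)%R | x in [set 1; t 0%R]]).
  have t0a : t 0%R != t (- a)%R.
    by apply/eqP=> /tI /esym/eqP; rewrite oppr_eq0 (negPf a0).
  have nle u v : u \in W -> v \in W -> len v <= len u -> u != v -> le u v = false.
    move=> uW vW h uv; apply: contraNF uv => uv; apply/eqP; exact: le_len_eq.
  have l2 (x : {perm pt}) : x \in [set 1; t 0%R] -> x \in W /\ len (x * t (- a)%R) = (len x).+1.
    by rewrite !inE => /orP[]/eqP->; rewrite ?mul1g ?group1 ?tW ?len1 ?le01 ?lt.
  have t0e : le (t 0%R) (t 0%R * t (- a)%R) by apply: (leI (tW _) (tW _) erefl); rewrite le01 !lt.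
  have tt u v : u \in W -> v \in W -> len v < len u -> le u v = false.
    by move=> uW vW h; apply: nle; rewrite // 1?ltnW //; apply: contraTneq h => ->; rewrite ltnn.
  have t10 : le (t (- a)%R) (t 0%R) = false by rewrite nle ?lt // eq_sym.
  apply: tiled_double X1.
  - exact: le_refl.
  - by move=> x y _ _ /mulIg.
  - by move=> x y /l2[xW lx] /l2[yW ly]; apply: le_mulr.
  - move=> x y; rewrite !inE => /orP[]/eqP-> /orP[]/eqP->; rewrite ?le1 ?mul1g ?le_refl ?t0e //.
    by rewrite nle ?tt ?lt ?len1 ?group1.
  - by move=> x y; rewrite !inE => /orP[]/eqP-> /orP[]/eqP->; rewrite ?mul1g ?t10 ?tt ?groupM ?group1 ?lt ?len1 ?le01 //.
  - by move=> x /l2[].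
have -> : [set 1; dg p nu a] :|: [set refl p (shift c nu) | c : C] =
  ([set 1; t 0%R] :|: [set x * t (- a)%R | x in [set 1; t 0%R]]) :|:
  [set t c | c in ~: [set 0%R; - a]%R].
  rewrite imsetU !imset_set1 mul1g -eE.
  apply/setP=> x; rewrite !inE; apply/idP/idP.
    case/orP=> [/orP[]->|/imsetP[c _ ->]]; rewrite ?orbT //.
    have [->|c0] := eqVneq c 0%R; first by rewrite eqxx !orbT.
    have [->|ca] := eqVneq c (- a)%R; first by rewrite eqxx !orbT.
    by apply/orP; right; apply/imsetP; exists c; rewrite // !inE negb_or c0.
  have im c : t c \in [set refl p (shift c nu) | c : C] by apply/imsetP; exists c.
  by case/orP=> [/orP[/orP[]|/orP[]]/eqP->|/imsetP[c _ ->]]; rewrite ?eqxx ?im ?orbT.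
apply: tiled_union => //.
  rewrite (_ : [set t c | c in _] = [set x in setT | x \in [set t c | c in ~: [set 0%R; - a]%R]]).
    apply: tiled_fibers => r /imsetP[c _ ->].
    rewrite (_ : [set x in _ | _] = [set t c]); last by apply/setP=> x; rewrite !inE.
    by have := tile_single (t c); rewrite lt.
  by apply/setP=> x; rewrite !inE.
rewrite -setI_eq0; apply/eqP/setP=> x; rewrite imsetU !imset_set1 mul1g -eE !inE.
apply/negbTE/negP=> /andP[h /imsetP[c]]; rewrite !inE negb_or => /andP[c0 ca] xt.
move: h; rewrite xt (inj_eq tI) (inj_eq tI) (negPf c0) (negPf ca) (negPf (n1t c)) /=.
by move/eqP=> h; have := lt c; rewrite h eE le01.
Qed.

Lemma rcosetUl (X Y : {set {perm pt}}) t : (X :|: Y) :* t = X :* t :|: Y :* t.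
Proof. by rewrite -!rcosetE /rcoset imsetU. Qed.

Lemma NC_off_line_cover w p (x : {perm pt}) : w \in W -> p.1 != (w p).1 ->
  [\/ x p = p \/ x p = w p,
      exists2 s, s != 0%R & x p = shift s p \/ x p = shift (- s)%R (w p)
    | (x p).1 != p.1 /\ (x p).1 != (w p).1].
Proof.
move=> wW pw; have [/esym/same_line[s xs]|xp] := eqVneq (x p).1 p.1.
  have [s0|s0] := eqVneq s 0%R; first by constructor 1; left; rewrite xs s0 shift0.
  by constructor 2; exists s; rewrite // xs; left.
have [/esym/same_line[s xs]|xq] := eqVneq (x p).1 (w p).1; last by constructor 3.
have [s0|s0] := eqVneq s 0%R; first by constructor 1; right; rewrite xs s0 shift0.
by constructor 2; exists (- s)%R; rewrite ?oppr_eq0 // opprK xs; right.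
Qed.

(* The exceptional case of the induction: the reflection [t] joining [p] to
   [w p] turned back by [a] lies below [w]. The fiber over [shift a p] has its ranks off
   centre by one half, and so has the fiber over the image of [p] under [t]; both are
   matched with parts of the fiber over [nu]. *)
Section Special.
Variables (w : {perm pt}) (p : pt).
Local Notation q := (w p).
Hypotheses (wW : w \in W) (wg : le w g) (pn : p.1 != n) (pq : p.1 != q.1).
Hypothesis IH : forall v, v \in W -> le v g -> len v < len w -> tile (len v) (NC v).
Local Notation t := (refl p (shift (- a)%R q)).
Local Notation t0 := (refl p nu).
Local Notation e := (dg p nu a).
Variable y2 : {perm pt}.
Hypotheses (lw : len w = (len (w * t)).+1) (y2W : y2 \in W) (yE : w * t = y2 * e).
Hypotheses (ly : len (w * t) = (len y2).+2) (y2p : y2 p = p) (y2n : y2 nu = nu).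

Let pr : p.1 != (shift (- a)%R q).1. Proof. by []. Qed.
Let tW : t \in W. Proof. exact: refl_W. Qed.
Let pnu : p.1 != nu.1. Proof. by []. Qed.
Let t0W : t0 \in W. Proof. exact: refl_W. Qed.
Let eW : e \in W. Proof. exact: dg_W. Qed.
Let yW : w * t \in W. Proof. by rewrite groupM. Qed.
Let yw : le (w * t) w. Proof. exact: le_mul_refl_self. Qed.
Let yg : le (w * t) g. Proof. exact: le_trans yw wg. Qed.
Let wE : w = y2 * e * t.
Proof. by rewrite -yE -mulgA reflK // mulg1. Qed.
Let yp : (w * t) p = shift a p.
Proof. by rewrite yE permM y2p dg_l. Qed.
Let y2y : le y2 (w * t).
Proof. by apply: (leI y2W eW yE); rewrite ly len_dg2 // addn2. Qed.

(** If [q] lay on the line of [nu], then [e * t] would be [refl p q], and [w = y2 * e * t] would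
    have length [(len y2).+1] and not [(len y2).+3]. *)
Let qn : q.1 != n.
Proof.
apply/negP=> /eqP qn; have [c qE] := same_line (x := nu) (y := q) (esym qn).
have et : e * t = refl p q.
  apply: equivariant_ext; try exact: W_equivariant (groupM eW tW).
    exact: refl_equivariant.
  move=> i; have [->|ip] := eqVneq i p.1.
    exists p => //; rewrite permM dg_l refl_equivariant refl_l shiftD addNr shift0.
    by rewrite refl_l.
  have [->|iN] := eqVneq i n.
    exists q => //; rewrite permM {2}qE dg_equivariant dg_r // shiftD addrC -shiftD -qE.
    by rewrite !refl_r.
  by exists (i, 0%R); rewrite // permM dg_out // !refl_out //= ?qn.
have := len_mul_refl_fixed y2W y2p pq.
by rewrite -et mulgA -wE lw ly => /eqP; rewrite eqSS gtn_eqF // ltnS leqnSn.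
Qed.

Let wn : w nu = shift (- a)%R nu.
Proof. by rewrite wE permM permM y2n dg_r // refl_out // eq_sym. Qed.

Let Q := NC y2.
Let QP (x : {perm pt}) : x \in Q -> [/\ x \in W, le x y2, x p = p & x nu = nu].
Proof. by case/NC_P=> xW xy; split=> //; apply: le_fixed xy _. Qed.

(** The complement of [x] in [w] sends [p] to [shift (- a) q], so [t] shortens it and [x] lies below
    [w * t]; both then split off [e] on the right. *)
Let fiber_turned : [set x in NC w | x p == shift a p] = Q :* e.
Proof.
apply/setP=> x; rewrite inE; apply/andP/rcosetP=> [[/NC_P[xW xw] /eqP xp]|[x' /QP[x'W x'y x'p _] ->]].
  have xy : le x (w * t).
    have [z zW [e1 e2]] := leP xW wW xw.
    have zp : z p = shift (- a)%R q.
      by rewrite e1 permM xp (W_equivariant zW) shiftD subrr shift0.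
    have pz : p.1 != (z p).1 by rewrite zp.
    have lz := len_mul_refl_moved zW pz; rewrite zp in lz.
    apply: (leI (z := z * t)); rewrite ?groupM //; first by rewrite {1}e1 mulgA.
    by rewrite -ltnS -lw e2 lz addnS.
  have [_ [x' [x'W xE lx _ _]]] := shift_noncentral xW (le_trans xW wW gW xw wg) pn a0 xp.
  exists x' => //; apply/NC_P; split=> //.
  have [z zW [e1 e2]] := leP' xW yW xy.
  apply: (leI' (z := z)) => //.
    have /mulIg // : y2 * e = z * x' * e by rewrite -yE e1 xE mulgA.
  by move: e2; rewrite ly lx !addSn => -[->].
have [z zW [e1 e2]] := leP' x'W y2W x'y.
split; last by rewrite permM x'p dg_l.
have xW : x' * e \in W by rewrite groupM.
apply/NC_P; split=> //; apply: (le_trans xW yW wW _ yw); apply: (leI' (z := z)) => //.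
  by rewrite yE e1 -mulgA.
rewrite ly e2 -2!addSn leq_add2r; have := lenM x'W eW.
by rewrite len_dg2 // addn2.
Qed.

(** The complement of [x * t] in [w * t] turns [p] by [a], hence ends in [e]; cancelling [e] leaves
    [x * t] below [y2]. *)
Let fiber_turned_back : [set x in NC w | x p == shift (- a)%R q] = Q :* t.
Proof.
apply/setP=> x; rewrite mem_rcoset reflV // !inE -andbA groupMr //.
have [xW|//] := boolP (x \in W); rewrite /= le_mul_refl // lw eqxx /=.
have x'W : x * t \in W by rewrite groupM.
apply/andP/idP=> [[h /eqP xp]|h]; last first.
  by split; [apply: le_trans h y2y|apply/eqP; apply: le_fixed h y2p].
have [z zW [e1 e2]] := leP x'W yW h.
have zp : z p = shift a p by rewrite -yp e1 permM xp.
have zy : le z (w * t) by apply: (leI' (z := x * t)); rewrite // e2 addnC.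
have [_ [z' [z'W zE lz _ _]]] := shift_noncentral zW (le_trans zW yW gW zy yg) pn a0 zp.
apply: (leI (z := z')) => //.
  have /mulIg // : y2 * e = x * t * z' * e by rewrite -yE e1 zE mulgA.
by move: e2; rewrite ly lz !addnS => -[->].
Qed.

Let c := w * t0 * refl p q.
Let v := refl nu (shift (- a)%R q).
Let vn : nu.1 != (shift (- a)%R q).1. Proof. by rewrite eq_sym. Qed.
Let vW : v \in W. Proof. exact: refl_W. Qed.
Let uW : refl p q \in W. Proof. exact: refl_W. Qed.
Let cW : c \in W. Proof. by rewrite !groupM. Qed.

(** This makes [Q :* v :* t0] the translate of [Q :* t0] by [t]. *)
Let v_t0 : v * t0 = t0 * t.
Proof.
have := reflJ (@refl_equivariant _ _ p nu) vn.
rewrite refl_r // refl_out //= ?(eq_sym q.1) // => <-.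
by rewrite conjgE reflV // !mulgA reflK // mul1g.
Qed.

(** This locates [Q] in the fiber over [nu]: the fibers of [NC c] over [nu] and over [c nu] are [Q]
    and [Q :* v]. *)
Let cv : c * v = y2.
Proof.
have t1W : refl nu (shift a p) \in W by rewrite refl_W // eq_sym.
have tE : t0 * refl p q * v = t * refl nu (shift a p) * t0.
  apply: equivariant_ext; try by apply: W_equivariant; rewrite !groupM.
  move=> i; have [->|ip] := eqVneq i p.1.
    exists p => //; rewrite !permM !refl_l (refl_out (x := p) (y := q)) ?refl_l //; last by rewrite eq_sym.
    rewrite (refl_out (y := shift a p)) // 1?eq_sym //.
    by rewrite (refl_out (y := nu)) // eq_sym.
  have [->|iq] := eqVneq i q.1.
    exists q => //; rewrite !permM (refl_out (y := nu)) // 1?eq_sym //.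
    have -> : t q = shift a p.
      have {2}-> : q = shift a (shift (- a)%R q) by rewrite shiftD addNr shift0.
      by rewrite refl_equivariant refl_r.
    rewrite (refl_r (y := q)) // (refl_r (y := shift a p)) 1?eq_sym //.
    by rewrite refl_r // refl_out // eq_sym.
  have [->|iN] := eqVneq i n.
    exists nu => //; rewrite !permM refl_r // refl_l.
    rewrite (refl_out (x := p) (y := shift _ _)) // 1?eq_sym // refl_l.
    have -> : v q = shift a nu.
      have {1}-> : q = shift a (shift (- a)%R q) by rewrite shiftD addNr shift0.
      by rewrite refl_equivariant refl_r.
    by rewrite refl_equivariant refl_l.
  by exists (i, 0%R); rewrite // !permM !refl_out.
have eE : e = t0 * refl nu (shift a p) by [].
have cvE : c * v = w * (t0 * refl p q * v) by rewrite /c -!mulgA.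
have := congr1 (fun x : {perm pt} => x * (t0 * refl p q * v)) wE; rewrite /= -cvE tE eE => ->.
set t1 := refl nu _ in t1W *.
have t11 : t1 * t1 = 1 by rewrite reflK // eq_sym.
rewrite -!mulgA [t * (t * _)]mulgA reflK // mul1g.
by rewrite [t1 * (t1 * _)]mulgA t11 mul1g reflK // mulg1.
Qed.

Let cE : c = y2 * v.
Proof. by rewrite -cv -mulgA reflK // mulg1. Qed.
Let lc : len c = (len y2).+1.
Proof. by rewrite cE len_mul_refl_fixed. Qed.
Let cn : c nu = shift (- a)%R q.
Proof. by rewrite cE permM y2n refl_l. Qed.
Let cp : c p = p.
Proof. by rewrite cE permM y2p refl_out // eq_sym. Qed.
Let lw3 : len w = (len y2).+3. Proof. by rewrite lw ly. Qed.

Let lwt0 : len w = (len (w * t0)).+1.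
Proof.
have wt0W : w * t0 \in W by rewrite groupM.
have wp : (w * t0) p = q by rewrite permM refl_out // eq_sym.
have := len_mul_refl_moved wt0W (_ : p.1 != ((w * t0) p).1).
by rewrite wp -/c lc => ->; rewrite // lw3.
Qed.

Let cg : le c g.
Proof.
have wt0W : w * t0 \in W by rewrite groupM.
apply: (le_trans (v := w)) => //; apply: (le_trans (v := w * t0)) => //; last exact: le_mul_refl_self.
by apply: le_mul_refl_self => //; rewrite -/c lc; move: lwt0; rewrite lw3 => -[->].
Qed.

Let fiber_center : [set x in NC w | x p == nu] = NC c :* t0.
Proof. by rewrite NC_fiber // eq_sym. Qed.

(** The pivot is now [nu] itself, which can be turned only by [- a]. That would make [c * refl nu q]
    shorter than [c], but it equals [w * refl p q], of length [len w - 1], which exceeds [len c]. *)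
Let center_not_special (x : {perm pt}) s : x \in NC c -> s != 0%R ->
  ~ (x nu = shift s nu \/ x nu = shift (- s)%R (c nu)).
Proof.
have nc : nu.1 != (c nu).1 by rewrite cn.
move=> xc s0 /(special_fiber cW nc s0 xc) l.
set b := refl _ _ in l; have bW : b \in W by apply: refl_W.
have cbW : c * b \in W by rewrite groupM.
have cbn : (c * b) nu = shift s nu.
  rewrite permM; have {1}-> : c nu = shift s (shift (- s)%R (c nu)).
    by rewrite shiftD addNr shift0.
  by rewrite refl_equivariant refl_r.
have cbc : le (c * b) c by apply: le_mul_refl_self.
have sa := shift_center cbW (le_trans cbW cW gW cbc cg) s0 cbn.
have bE : b = refl nu q.
  by rewrite /b sa opprK cn shiftD addNr shift0.
have nq : nu.1 != q.1 by rewrite eq_sym.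
have cb : c * b = w * refl p q.
  rewrite /c -!mulgA; congr (_ * _); rewrite bE.
  rewrite (reflC (x := nu)) // mulgA; apply: equivariant_ext; try by apply: W_equivariant; rewrite ?groupM // refl_W.
  move=> i; have [->|ip] := eqVneq i p.1.
    by exists p; rewrite // !permM !refl_l (refl_out (x := p) (y := q)) 1?eq_sym // refl_r // eq_sym.
  have [->|iq] := eqVneq i q.1.
    exists q; rewrite // !permM (refl_out (x := p) (y := nu)) // 1?eq_sym //.
    by rewrite refl_r // refl_out // eq_sym.
  have [->|iN] := eqVneq i n.
    exists nu; rewrite // !permM refl_r // refl_l refl_l.
    by rewrite refl_out // eq_sym.
  by exists (i, 0%R); rewrite // !permM !refl_out.
have := len_mul_refl_moved wW pq; rewrite -cb lw3 => -[h].
by move: l; rewrite -h lc => /eqP; rewrite eqSS ltn_eqF // ltnS leqnSn.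
Qed.

Lemma tile_NC_special : tile (len w) (NC w).
Proof.
pose S := [set r : pt | [&& r.1 != p.1, r.1 != q.1 & r != nu]].
pose S1 := [set r : pt | (r.1 != n) && (r.1 != q.1)].
pose Rest := [set x in NC c | x nu \in S1].
pose t1 := refl p (shift a nu).
have nc : nu.1 != (c nu).1 by rewrite cn.
have t1t0 : t1 * t0 = e.
  have t10 : refl p (shift a nu) ^ t0 = refl nu (shift a p).
    by rewrite (reflJ (@refl_equivariant _ _ p nu)) // refl_l refl_equivariant refl_r.
  rewrite /t1 -[LHS]mul1g -(reflK pnu) -mulgA; congr (_ * _).
  by rewrite -t10 conjgE reflV // mulgA.
have QW : Q \subset W := NC_W y2.
have QQ : tile (len y2) Q.
  apply: IH => //; last by rewrite lw3 ltnS -addn2 leq_addr.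
  exact: le_trans y2y yg.
have dbl y : p.1 != y.1 -> tile (len y2).+1 (Q :|: Q :* refl p y).
  by move=> py; apply: tile_doubling => // x /QP[].
have lQt0 (x : {perm pt}) y : x \in Q -> p.1 != y.1 -> len (x * refl p y) = (len x).+1.
  by move=> /QP[xW _ xp _] py; apply: len_mul_refl_fixed.
have QUW y : p.1 != y.1 -> Q :|: Q :* refl p y \subset W.
  move=> py; rewrite subUset QW; apply/subsetP=> _ /rcosetP[x /QP[xW _ _ _] ->].
  by rewrite groupM // refl_W.
have NCc : NC c = Q :|: Q :* v :|: Rest.
  have f1 := NC_fiber_fixed cW nc; have f2 := NC_fiber_top cW nc.
  rewrite cn -/v cv -/Q in f1 f2; rewrite -f2 -f1.
  apply/setP=> x; rewrite !inE; case xc: (x \in NC c) => //=; last first.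
    by move: xc; rewrite inE => ->.
  move: (xc); rewrite inE => ->; rewrite /=; apply/esym.
  have [[->|->]|[s s0 h]|[h1 h2]] := NC_off_line_cover x cW nc.
  - by rewrite eqxx.
  - by rewrite cn eqxx orbT.
  - by case: (center_not_special xc s0).
  - by move: h2; rewrite h1 cn /= => ->; rewrite orbT.
have Z1 : tile (len w) (Rest :* t0).
  have lwc : len w = (len c).+2 by rewrite lw3 lc.
  rewrite lwc; apply: tile_rcoset => //.
  - by apply/subsetP=> x; rewrite inE => /andP[/(subsetP (NC_W c))].
  - move=> x; rewrite inE => /andP[/NC_P[xW xc] _].
    by apply: len_mul_refl_fixed => //; apply: le_fixed xc cp.
  apply: tile_off_lines => // [r|u u_W ug lu].
    by rewrite inE cn => /andP.
  by apply: IH => //; apply: leq_trans lu _; rewrite lw3 lc -addn2 leq_addr.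
(* The lower half [Q :* t0] lies over [nu], the upper half [Q :* e] over [shift a p]. *)
have Z2 : tile (len w) ((Q :|: Q :* t1) :* t0).
  rewrite lw3; apply: tile_rcoset (dbl _ _) => //; first exact: QUW.
  move=> x; rewrite inE => /orP[xQ|/rcosetP[x' x'Q ->]]; first exact: lQt0.
  rewrite -mulgA t1t0 lQt0 //; have [x'W x'y x'p _] := QP x'Q.
  (* [e] adds 2 to the length of [y2], hence also to that of its right factor [x']. *)
  have [z zW [e1 e2]] := leP' x'W y2W x'y.
  apply/eqP; rewrite eqn_leq; apply/andP; split.
    by have := lenM x'W eW; rewrite len_dg2 // addn2.
  have h := lenM zW (groupM x'W eW).
  by rewrite mulgA -e1 -yE ly e2 -2!addSn [X in X <= _]addnC leq_add2l in h.
(* The lower half [Q :* t] lies over [shift (- a) q], the upper half [Q :* v :* t0] over [nu]. *)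
have Z3 : tile (len w) ((Q :|: Q :* t0) :* t).
  rewrite lw3; apply: tile_rcoset (dbl _ _) => //; first exact: QUW.
  move=> x; rewrite inE => /orP[xQ|/rcosetP[x' x'Q ->]]; first exact: lQt0.
  rewrite -mulgA -v_t0 mulgA (lQt0 x') //; have [x'W x'y x'p x'n] := QP x'Q.
  have x'v : len (x' * v) = (len x').+1 by apply: len_mul_refl_fixed.
  rewrite len_mul_refl_fixed ?groupM ?x'v //.
  by rewrite permM x'p refl_out // eq_sym.
have A := tile_on_pivot wW wg pq IH.
have B : tile (len w) [set x in NC w | x p \in S].
  by apply: tile_off_lines => // r; rewrite inE => /and3P[].
have Z2E : (Q :|: Q :* t1) :* t0 = Q :* t0 :|: Q :* e.
  by rewrite rcosetUl -rcosetM t1t0.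
have Z3E : (Q :|: Q :* t0) :* t = Q :* t :|: Q :* v :* t0.
  by rewrite rcosetUl -!rcosetM -v_t0.
have c_t0 : NC c :* t0 = Q :* t0 :|: Q :* v :* t0 :|: Rest :* t0.
  by rewrite NCc !rcosetUl.
have NCw : NC w = [set x in NC w | x p \in [set p; q]] :|: [set x in NC w | x p \in S]
    :|: (Rest :* t0 :|: (Q :|: Q :* t1) :* t0 :|: (Q :|: Q :* t0) :* t).
  have -> : Rest :* t0 :|: (Q :|: Q :* t1) :* t0 :|: (Q :|: Q :* t0) :* t =
      [set x in NC w | x p == nu] :|: [set x in NC w | x p == shift a p]
      :|: [set x in NC w | x p == shift (- a)%R q].
    rewrite fiber_center fiber_turned fiber_turned_back Z2E Z3E c_t0.
    apply/setP=> x; rewrite !inE.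
    by do 5 case: (x \in _ :* _) => //.
  apply/setP=> x; rewrite !inE; case xw: (x \in NC w); last first.
    by move: xw; rewrite inE => ->.
  move: (xw); rewrite inE => ->; rewrite /=; apply/esym.
  have [[->|->]|[s s0 h]|[h1 h2]] := NC_off_line_cover x wW pq.
  - by rewrite eqxx.
  - by rewrite eqxx orbT.
  - have l := special_fiber wW pq s0 xw h.
    have pr' : p.1 != (shift (- s)%R q).1 by [].
    have bW := refl_W pr'; set b := refl _ _ in l bW.
    have wbW : w * b \in W by rewrite groupM.
    have wbp : (w * b) p = shift s p.
      rewrite permM; have {1}-> : q = shift s (shift (- s)%R q).
        by rewrite shiftD addNr shift0.
      by rewrite refl_equivariant refl_r.
    have wbg : le (w * b) g by apply: le_trans wg => //; apply: le_mul_refl_self.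
    have [sa _] := shift_noncentral wbW wbg pn s0 wbp.
    by case: h => ->; rewrite sa ?eqxx ?orbT.
  - by rewrite h1 h2 /=; case: (x p == nu); rewrite ?orbT.
rewrite NCw.
(* The pieces are told apart by the image of [p] and, inside the fiber over [nu], by the image of
   [nu] under [x * t0]. *)
have fibZ (X : {set {perm pt}}) r (x : {perm pt}) : [set y in NC w | y p == r] = X -> x \in X -> x p = r.
  by move=> <-; rewrite inE => /andP[_ /eqP].
have c1 (x : {perm pt}) := fibZ _ _ x fiber_center.
have c2 (x : {perm pt}) := fibZ _ _ x fiber_turned.
have c3 (x : {perm pt}) := fibZ _ _ x fiber_turned_back.
have sub1 (x : {perm pt}) : x \in Q :* t0 -> x p = nu /\ (x * t0) nu = nu.
  move=> xQ; split; first by apply: c1; rewrite c_t0 !inE xQ.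
  by case/rcosetP: xQ => x' /QP[_ _ _ x'n] ->; rewrite -mulgA reflK // mulg1.
have sub2 (x : {perm pt}) : x \in Q :* v :* t0 -> x p = nu /\ (x * t0) nu = shift (- a)%R q.
  move=> xQ; split; first by apply: c1; rewrite c_t0 !inE xQ orbT.
  case/rcosetP: xQ => _ /rcosetP[x' /QP[_ _ _ x'n] ->] ->.
  by rewrite -mulgA reflK // mulg1 permM x'n refl_l.
have sub3 (x : {perm pt}) : x \in Rest :* t0 -> x p = nu /\ (x * t0) nu \in S1.
  move=> xQ; split; first by apply: c1; rewrite c_t0 !inE xQ orbT.
  case/rcosetP: xQ => x'; rewrite inE => /andP[_ x'S] ->.
  by rewrite -mulgA reflK // mulg1.
have S1n : nu \notin S1 by rewrite inE eqxx.
have S1q : shift (- a)%R q \notin S1 by rewrite inE eqxx andbF.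
have np x y : x.1 != y.1 -> x <> y by move=> xy e'; rewrite e' eqxx in xy.
have n1 := np _ _ (pnu : (shift a p).1 != nu.1).
have n2 := np _ _ (qn : (shift (- a)%R q).1 != nu.1).
have n3 := np _ _ (pq : (shift a p).1 != (shift (- a)%R q).1).
have disj (X Y : {set {perm pt}}) : (forall x : {perm pt}, x \in X -> x \in Y -> False) -> [disjoint X & Y].
  move=> h; rewrite -setI_eq0; apply/eqP/setP=> x; rewrite !inE.
  by apply/negbTE/negP=> /andP[xX xY]; apply: (h x).
apply: tiled_union; [apply: tiled_union => //| |].
- apply: disj => x; rewrite !inE => /andP[_ /orP[]/eqP->] /andP[_ /and3P[]].
    by rewrite eqxx.
  by rewrite eqxx.
- apply: tiled_union => //; first apply: tiled_union => //.
    apply: disj => x /sub3[x1 x2]; rewrite Z2E inE => /orP[/sub1[_ x3]|/c2 x3].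
      by move: S1n; rewrite -x3 x2.
    by apply: n1; rewrite -x3 x1.
  apply: disj => x; rewrite inE => /orP[/sub3[x1 x2]|].
    rewrite Z3E inE => /orP[/c3 x3|/sub2[_ x3]]; first by apply: n2; rewrite -x3 x1.
    by move: S1q; rewrite -x3 x2.
  rewrite Z2E inE => /orP[/sub1[x1 x2]|/c2 x1].
    rewrite Z3E inE => /orP[/c3 x3|/sub2[_ x3]]; first by apply: n2; rewrite -x3 x1.
    by apply: n2; rewrite -x3 x2.
  rewrite Z3E inE => /orP[/c3 x3|/sub2[x3 _]]; first by apply: n3; rewrite -x3 x1.
  by apply: n1; rewrite -x3 x1.
apply: disj => x xAB xZ.
have : [\/ x p = nu, x p = shift a p | x p = shift (- a)%R q].
  move: xZ; rewrite inE => /orP[|].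
    rewrite inE => /orP[/sub3[x1 _]|]; first by constructor 1.
    by rewrite Z2E inE => /orP[/sub1[x1 _]|/c2 x1]; [constructor 1|constructor 2].
  by rewrite Z3E inE => /orP[/c3 x1|/sub2[x1 _]]; [constructor 3|constructor 1].
have qn' : (q == nu) = false by apply/eqP=> /(congr1 fst)/= h; case/eqP: qn.
have pn' : (p == nu) = false by apply/eqP=> /(congr1 fst)/= h; case/eqP: pn.
move: xAB; rewrite inE => /orP[]; rewrite inE => /andP[_].
  rewrite !inE => h [] e'; move: h; rewrite e'.
  - by rewrite ![nu == _]eq_sym qn' pn'.
  - rewrite shift_id (negPf a0) => /eqP h; by case/eqP: pq; rewrite -h.
  - rewrite shift_id oppr_eq0 (negPf a0) orbF => /eqP h; by case/eqP: pq; rewrite -{1}h.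
rewrite inE => h [] e'; move: h; rewrite e' ?eqxx ?andbF //.
Qed.
End Special.

Theorem tile_NC w : w \in W -> le w g -> tile (len w) (NC w).
Proof.
elim: {w}(len w).+1 {-2}w (leqnn (len w).+1) => // k IHk w lwk wW wg.
have IH u : u \in W -> le u g -> len u < len w -> tile (len u) (NC u).
  by move=> uW ug uw; apply: IHk => //; apply: leq_trans uw _; rewrite -ltnS.
have ew := W_equivariant wW.
have [i /andP[iN wi]|none] := pickP (fun i => (i != n) && ((w (i, 0%R)).1 != i)); last first.
  have on i : i != n -> exists s, w (i, 0%R) = shift s (i, 0%R).
    move=> iN; apply: same_line; apply/esym/eqP.
    by have := none i; rewrite iN => /negbFE.
  have [i /andP[iN wi]|allfix] := pickP (fun i => (i != n) && (w (i, 0%R) != (i, 0%R))); last first.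
    have -> : w = 1.
      apply: (W_moves_two (i0 := n)) => // i iN; apply/eqP.
      by have := allfix i; rewrite iN => /negbFE.
    by rewrite NC1; have := tile_single 1; rewrite len1.
  have [s ws] := on i iN; have s0 : s != 0%R by move: wi; rewrite ws shift_id.
  have [_ [v [vW wE lw vp vn]]] := shift_noncentral wW wg (iN : (i, 0%R : C).1 != n) s0 ws.
  have ev := W_equivariant vW.
  have v1 : v = 1.
    apply: (W_moves_two (i0 := n)) => // j jN; have [->//|ji] := eqVneq j i.
    have vl : j = (v (j, 0%R)).1.
      have := none j; rewrite jN wE permM => /negbFE/eqP; set x := v _.
      have [xi|xi] := eqVneq x.1 i.
        have [c xc] := same_line (x := (i, 0%R)) (y := x) (esym xi).
        by rewrite xc dg_equivariant dg_l /= => ij; rewrite ij eqxx in ji.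
      have [xn|xn] := eqVneq x.1 n; last by rewrite dg_out.
      have [c xc] := same_line (x := nu) (y := x) (esym xn).
      by rewrite xc dg_equivariant dg_r //= => nj; rewrite nj eqxx in jN.
    have [s' vs] := same_line (x := (j, 0%R)) vl.
    have [s'0|s'0] := eqVneq s' 0%R; first by rewrite vs s'0 shift0.
    have vw : le v w by apply: (leI (z := dg (i, 0%R) nu a)); rewrite ?dg_W // lw len_dg2 // addn2.
    (* Turning a second line would make [v] turn [nu], which it fixes. *)
    have [_ [v' [_ vE _ _ v'n]]] := shift_noncentral vW (le_trans vW wW gW vw wg) (jN : (j, 0%R : C).1 != n) s'0 vs.
    by move/eqP: vn; rewrite vE permM v'n dg_r // shift_id oppr_eq0 (negPf a0).
  have {}wE : w = dg (i, 0%R) nu a by rewrite wE v1 mul1g.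
  by rewrite {1}wE len_dg2 // wE; apply: tile_dg => //; rewrite -wE.
set p : pt := (i, 0%R) in wi; have pn : p.1 != n by [].
have pq : p.1 != (w p).1 by rewrite eq_sym.
have [/existsP[s /andP[s0 /eqP l]]|/existsPn nospecial] := boolP [exists s : C,
    (s != 0%R) && (len w == (len (w * refl p (shift (- s)%R (w p)))).+1)].
  have pr : p.1 != (shift (- s)%R (w p)).1 by [].
  have yW : w * refl p (shift (- s)%R (w p)) \in W by rewrite groupM // refl_W.
  have yw := le_mul_refl_self wW pr l.
  have yp : (w * refl p (shift (- s)%R (w p))) p = shift s p.
    rewrite permM; have {2}-> : w p = shift s (shift (- s)%R (w p)).
      by rewrite shiftD addNr shift0.
    by rewrite refl_equivariant refl_r.
  have [sa [y2 [y2W yE ly y2p y2n]]] := shift_noncentral yW (le_trans yW wW gW yw wg) pn s0 yp.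
  rewrite {}sa in l yE ly.
  exact: (tile_NC_special wW wg pn pq IH l y2W yE ly y2p y2n).
pose S := [set r : pt | (r.1 != p.1) && (r.1 != (w p).1)].
have -> : NC w = [set x in NC w | x p \in [set p; w p]] :|: [set x in NC w | x p \in S].
  apply/setP=> x; rewrite !inE; case xw: (x \in NC w); last first.
    by move: xw; rewrite inE => ->.
  move: (xw); rewrite inE => ->; rewrite /=; apply/esym.
  have [[->|->]|[s s0 h]|[h1 h2]] := NC_off_line_cover x wW pq.
  - by rewrite eqxx.
  - by rewrite eqxx orbT.
  - by have := nospecial s; rewrite s0 -(special_fiber wW pq s0 xw h) eqxx.
  - by rewrite h1 h2 orbT.
apply: tiled_union; first exact: tile_on_pivot.
  by apply: tile_off_lines => // r; rewrite inE => /andP.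
rewrite -setI_eq0; apply/eqP/setP=> x; rewrite !inE.
apply/negbTE/negP=> /andP[/andP[_ h] /andP[_ /andP[h1 h2]]].
by case/orP: h h1 h2 => /eqP->; rewrite eqxx.
Qed.

End CoxeterElement.

(** * The reflection group as the kernel of the weight *)

Section ReflectionGroup.
Import GroupScope GRing.Theory.
Variables (I : finType) (C : finZmodType).
Local Notation pt := (I * C)%type.
Local Notation W := (W I C).
Implicit Types (x y : pt) (s c : C) (u v w t : {perm pt}).

(** The logarithm of the product of the nonzero entries. *)
Definition weight w : C := (\sum_i (w (i, 0%R)).2)%R.

Lemma weightM v w : equivariant v -> equivariant w -> weight (v * w) = (weight v + weight w)%R.
Proof.
move=> ev ew; rewrite /weight.
have inj : injective (fun i => (v (i, 0%R)).1).
  by move=> i j /eqP; rewrite equivariant_line // => /eqP.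
rewrite [in X in (_ + X)%R](reindex_inj inj) -big_split /=; apply: eq_bigr => i _.
rewrite permM; have [c ->] := same_line (x := ((v (i, 0%R)).1, 0%R)) (y := v (i, 0%R)) erefl.
by rewrite ew /= add0r addrC.
Qed.

Lemma weight_refl x y : x.1 != y.1 -> weight (refl x y) = 0%R.
Proof.
move=> xy; rewrite /weight (bigD1 x.1) // (bigD1 y.1) 1?eq_sym //=.
rewrite big1 => [|i /andP[ix iy]]; last by rewrite refl_out.
rewrite !permE /refl_fun /= eqxx eq_sym (negPf xy) eqxx /= addr0.
by rewrite !sub0r ?addr0 addrA subrK subrr.
Qed.

Lemma weight_words k w : w \in refls I C ^+ k -> weight w = 0%R.
Proof.
elim: k w => [|k IH] w.
  by rewrite expg0 => /set1gP->; rewrite /weight big1 // => i _; rewrite perm1.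
rewrite expgS => /mulsgP[t v tT vk ->].
rewrite (weightM (refls_equivariant tT) (words_equivariant vk)) (IH v vk) addr0.
by case/reflsP: tT => x [y [xy ->]]; rewrite weight_refl.
Qed.

(** A reflection or, when every line is stable, a [dg] makes one more line fixed; weight 0 provides
    the second turned line that the [dg] needs. *)
Lemma mem_W w : reflect (equivariant w /\ weight w = 0%R) (w \in W).
Proof.
apply: (iffP idP) => [wW|[]].
  by have [k wk] := W_words wW; split; [apply: words_equivariant wk|apply: weight_words wk].
pose moved u := [set i | u (i, 0%R) != (i, 0%R)].
elim: {w}#|moved w| {-2}w (leqnn #|moved w|) => [|k IH] w.
  rewrite leqn0 cards_eq0 => /eqP m0 ew _; suff -> : w = 1 by apply: group1.
  apply: equivariant_ext => //; first exact: equivariant1.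
  move=> i; exists (i, 0%R); rewrite // perm1; apply/eqP/negPn.
  by have := in_set0 i; rewrite -m0 inE => ->.
move=> mk ew w0.
(* If [t] fixes every line fixed by [w], and [w * t] also fixes the line [i], then
   [w * t] moves fewer lines. *)
have step t i : t \in W -> i \in moved w -> (w * t) (i, 0%R) = (i, 0%R) ->
    (forall j, j \notin moved w -> t (j, 0%R) = (j, 0%R)) -> w \in W.
  move=> tW iM wti tfix; rewrite -(groupMr w tW); apply: IH.
  - rewrite -ltnS; apply: leq_trans mk; apply/proper_card/properP; split; last first.
      by exists i; rewrite // inE wti eqxx.
    apply/subsetP=> j; apply: contraLR => jM; rewrite inE negbK permM.
    by move: (jM); rewrite inE negbK => /eqP->; rewrite tfix.
  - by apply: equivariantM => //; apply: W_equivariant.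
  have [l tl] := W_words tW.
  by rewrite (weightM ew (W_equivariant tW)) (weight_words tl) w0 addr0.
have fixed i j : j \notin moved w -> (w (i, 0%R)).1 = j -> i = j.
  rewrite inE negbK => /eqP wj e; apply/eqP.
  by rewrite -[_ == _](equivariant_line (i, 0%R) (j, 0%R) ew) wj e.
have [i /andP[iM wi]|on] := pickP (fun i => (i \in moved w) && ((w (i, 0%R)).1 != i)).
  have wi' : ((i, 0%R) : pt).1 != (w (i, 0%R)).1 by rewrite eq_sym.
  apply: (step (refl (i, 0%R) (w (i, 0%R))) i) => //; first exact: refl_W.
    by rewrite permM refl_r.
  move=> j jM; rewrite refl_out //=; first by apply: contraNneq jM => ->.
  apply: contraNneq jM => jw; rewrite jw; apply: contraR wi => jM.
  by rewrite -jw (fixed _ _ _ (esym jw)) ?jw.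
have line i : exists c, w (i, 0%R) = shift c (i, 0%R).
  apply: same_line; apply/esym/eqP; have := on i.
  by have [_ /negbFE//|] := boolP (i \in moved w); rewrite inE negbK => /eqP->.
have [m0|/set0Pn[i iM]] := eqVneq (moved w) set0.
  suff -> : w = 1 by apply: group1.
  apply: equivariant_ext => //; first exact: equivariant1.
  move=> i; exists (i, 0%R); rewrite // perm1; apply/eqP/negPn.
  by have := in_set0 i; rewrite -m0 inE => ->.
have [c wi] := line i.
have c0 : c != 0%R by move: iM; rewrite inE wi shift_id.
have [j /andP[jM ij]|only] := pickP (fun j => (j \in moved w) && (j != i)); last first.
  case/eqP: c0; move: w0; rewrite /weight (bigD1 i) //= wi big1 ?addr0 /= ?add0r // => j ji.
  by have := only j; rewrite ji andbT inE => /negbFE/eqP->.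
have ij' : ((i, 0%R) : pt).1 != ((j, 0%R) : pt).1 by rewrite eq_sym.
apply: (step (dg (i, 0%R) (j, 0%R) (- c)%R) i) => //; first exact: dg_W.
  by rewrite permM wi dg_equivariant dg_l shiftD addNr shift0.
by move=> l lM; rewrite dg_out //=; apply: contraNneq lM => ->.
Qed.

End ReflectionGroup.

(** * Monomial matrices *)

Section MonomialMatrices.
Import GroupScope GRing.Theory.
Local Open Scope ring_scope.
Variables (d n : nat).
Hypothesis d_gt1 : (1 < d)%N.
Variable z : algC.
Hypothesis z_prim : d.-primitive_root z.
Local Notation I := 'I_n.
Local Notation C := 'Z_d.
Local Notation pt := (I * C)%type.
Local Notation W := (W I C).
Implicit Types (u v w t : {perm pt}) (c : C).

Definition root_of c : algC := z ^+ c.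

Let z0 : z != 0.
Proof. by apply: contraTneq (prim_order_gt0 z_prim) => z0; rewrite -leqNgt; have := prim_expr_order z_prim; rewrite z0 expr0n; case: d => // k /eqP; rewrite eq_sym oner_eq0. Qed.

Lemma root_ofD c1 c2 : root_of (c1 + c2) = root_of c1 * root_of c2.
Proof.
rewrite /root_of -exprD -[RHS](prim_expr_mod z_prim); congr (z ^+ _).
have -> : nat_of_ord (c1 + c2) = ((c1 + c2)%N %% (Zp_trunc d).+2)%N by [].
by move: (c1 + c2)%N => m; rewrite Zp_cast.
Qed.

Lemma root_of0 : root_of 0 = 1.
Proof. by rewrite /root_of expr0. Qed.

Lemma root_of_mulrn c m : root_of (c *+ m) = root_of c ^+ m.
Proof. by elim: m => [|m IH]; rewrite ?mulr0n ?root_of0 // mulrS root_ofD IH exprS. Qed.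

Lemma root_of_neq0 c : root_of c != 0.
Proof. exact: expf_neq0. Qed.

Lemma root_of_inj : injective root_of.
Proof.
move=> c1 c2 /eqP; rewrite (eq_prim_root_expr z_prim) => /eqP h; apply: val_inj.
have lt (c : C) : (c < d)%N by rewrite -[X in (_ < X)%N](Zp_cast d_gt1) ltn_ord.
by move: h; rewrite !modn_small.
Qed.

Lemma root_of_expr c : root_of c ^+ d = 1.
Proof. by rewrite /root_of -exprM mulnC exprM (prim_expr_order z_prim) expr1n. Qed.

Lemma root_of_surj (x : algC) : x ^+ d = 1 -> exists c, x = root_of c.
Proof.
move=> xd; have [i ->] := prim_rootP z_prim xd.
have id : (i < (Zp_trunc d).+2)%N by rewrite Zp_cast.
by exists (Ordinal id).
Qed.

Lemma root_of_sum (J : finType) (P : pred J) (F : J -> C) :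
  root_of (\sum_(j | P j) F j) = \prod_(j | P j) root_of (F j).
Proof. exact: (big_morph root_of root_ofD root_of0). Qed.

(** Row [i] records the image of the [i]-th basis vector, which turns the right action into the
    product of matrices. *)
Definition mx_of w : 'M[algC]_n :=
  \matrix_(i, j) if (w (i, 0)).1 == j then root_of (w (i, 0)).2 else 0.

Lemma mx_of1 : mx_of 1%g = 1%:M.
Proof. by apply/matrixP=> i j; rewrite !mxE perm1 /= root_of0; case: eqP. Qed.

Lemma mx_ofM v w : equivariant w -> mx_of (v * w)%g = mx_of v *m mx_of w.
Proof.
move=> ew; apply/matrixP=> i k; rewrite !mxE permM.
rewrite (bigD1 (v (i, 0)).1) //= !mxE eqxx big1 ?addr0 => [|j jv]; last first.
  by rewrite !mxE eq_sym (negPf jv) mul0r.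
have [c e] := same_line (x := ((v (i, 0)).1, 0)) (y := v (i, 0)) erefl.
have c2 : (v (i, 0)).2 = c by rewrite e /= add0r.
by rewrite c2 {1 2}e !ew /= root_ofD; case: eqP => _; rewrite ?mulr0 // mulrC.
Qed.

Lemma mx_of_inj v w : equivariant v -> equivariant w -> mx_of v = mx_of w -> v = w.
Proof.
move=> ev ew e; apply: equivariant_ext => // i; exists (i, 0) => //.
have := congr1 (fun A : 'M[algC]_n => A i (v (i, 0)).1) e; rewrite !mxE eqxx.
case: eqP => [e1 /root_of_inj e2|_ /eqP]; last by rewrite (negPf (root_of_neq0 _)).
by rewrite [LHS]surjective_pairing [RHS]surjective_pairing e2 e1.
Qed.

Lemma mx_of_neq0 w i j : (mx_of w i j != 0) = ((w (i, 0)).1 == j).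
Proof. by rewrite mxE; case: ifP => _; rewrite ?root_of_neq0 ?eqxx. Qed.

Lemma in_W_mx_of w : equivariant w -> in_W d (mx_of w) = (weight w == 0).
Proof.
move=> ew; rewrite /in_W.
have -> : [forall i, #|[pred j | mx_of w i j != 0]| == 1%N].
  apply/forallP=> i; apply/eqP/(@eq_card1 _ (w (i, 0)).1) => j.
  by rewrite !inE mx_of_neq0 eq_sym.
have -> : [forall j, #|[pred i | mx_of w i j != 0]| == 1%N].
  apply/forallP=> j; apply/eqP/(@eq_card1 _ (w^-1%g (j, 0)).1) => i.
  rewrite !inE mx_of_neq0 -[in RHS]/((i, 0 : C).1) -(equivariant_line _ _ ew) permKV.
  by [].
have -> : [forall i, forall j, (mx_of w i j != 0) ==> (mx_of w i j ^+ d == 1)].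
  apply/'forall_forallP=> i j; apply/implyP; rewrite mx_of_neq0 mxE => ->.
  by rewrite root_of_expr.
rewrite /= (eq_bigr (fun i => root_of (w (i, 0)).2)) => [|i _]; last first.
  rewrite (big_pred1 (w (i, 0)).1) => [|j]; last by rewrite mx_of_neq0 eq_sym.
  by rewrite mxE eqxx.
by rewrite -root_of_sum -(inj_eq root_of_inj) root_of0.
Qed.

Lemma in_W_mx_ofP (A : 'M[algC]_n) :
  reflect (exists2 w, w \in W & A = mx_of w) (in_W d A).
Proof.
apply: (iffP idP) => [AW|[w /mem_W[ew w0] ->]]; last by rewrite in_W_mx_of ?w0.
have [/forallP rA /forallP cA /'forall_forallP dA _] := and4P AW.
have A1 i : exists j, [forall k, (A i k != 0) == (k == j)].
  by have /card1P[j hj] := rA i; exists j; apply/forallP=> k; have := hj k; rewrite !inE => ->.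
have A2 i j j' : A i j != 0 -> A j' j != 0 -> i = j'.
  have /card1P[k hk] := cA j; have := hk i; have := hk j'; rewrite !inE.
  by move=> -> -> /eqP-> /eqP->.
pose s i := xchoose (A1 i).
have sE i k : (A i k != 0) = (k == s i) by have /forallP/(_ k)/eqP := xchooseP (A1 i).
have C1 i : exists c, A i (s i) == root_of c.
  have [|c ->] := @root_of_surj (A i (s i)); last by exists c.
  by apply/eqP/(implyP (dA i (s i))); rewrite sE.
pose c i := xchoose (C1 i).
have cE i : A i (s i) = root_of (c i) by apply/eqP/(xchooseP (C1 i)).
have s_inj : injective s.
  by move=> i j ij; apply: (@A2 _ (s i)); rewrite ?sE ?ij.
have f_inj : injective (fun x : pt => (s x.1, x.2 + c x.1)).
  move=> [i a] [j b] /= e; have /s_inj ij := congr1 fst e.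
  by have /= := congr1 snd e; rewrite ij => /addIr ->.
pose w := perm f_inj.
have ew : equivariant w.
  by move=> b [i a]; rewrite !permE /shift /= addrAC.
have Aw : A = mx_of w.
  apply/matrixP=> i j; rewrite mxE permE /= add0r -cE eq_sym.
  by case: eqP => [<-//|/eqP]; rewrite -sE negbK => /eqP.
exists w => //; apply/mem_W; split=> //; apply/eqP.
by rewrite -in_W_mx_of // -Aw.
Qed.

Lemma rank1_minor (F : fieldType) (m : nat) (A : 'M[F]_m) i j k l :
  \rank A = 1%N -> A i j * A k l = A i l * A k j.
Proof.
move=> r1; rewrite -(mulmx_base A); move: (col_base A) (row_base A); rewrite r1.
by move=> c r; rewrite !mxE !big_ord1 mulrACA [r 0 j * _]mulrC mulrACA.
Qed.

(** Vanishing of the 2 by 2 minors of [w - 1] forces any two moved lines to be exchanged, so exactly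
    two lines move; conversely [w - 1] is a column times a row. *)
Lemma is_reflection_mx_of w : w \in W -> is_reflection d (mx_of w) = (w \in refls I C).
Proof.
move=> wW; have /mem_W[ew w0] := wW; rewrite /is_reflection in_W_mx_of // w0 eqxx /=.
set B := mx_of w - 1%:M.
have BE i j : B i j = (if (w (i, 0)).1 == j then root_of (w (i, 0)).2 else 0) - (i == j)%:R.
  by rewrite !mxE.
apply/eqP/idP=> [r1|/reflsP[x [y [xy wE]]]].
  have Bii i : w (i, 0) != (i, 0) -> B i i != 0.
    move=> wi; rewrite BE eqxx; have [wi1|_] := eqVneq (w (i, 0)).1 i; last first.
      by rewrite sub0r oppr_eq0 oner_eq0.
    rewrite subr_eq0 -root_of0; apply: contraNneq wi => /root_of_inj wi2.
    by rewrite [w _]surjective_pairing wi1 wi2.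
  have swap i k : w (i, 0) != (i, 0) -> w (k, 0) != (k, 0) -> i != k ->
      (w (i, 0)).1 = k.
    move=> wi wk ik; have : B i k * B k i != 0.
      by rewrite -(rank1_minor i i k k r1) mulf_neq0 ?Bii.
    rewrite mulf_eq0 negb_or => /andP[+ _]; rewrite BE (negPf ik) subr0.
    by have [//|_] := eqVneq (w (i, 0)).1 k; rewrite eqxx.
  have [i wi|all] := pickP (fun i => w (i, 0) != (i, 0)); last first.
    have B0 : B = 0.
      apply/matrixP=> i j; rewrite BE mxE; have := all i => /negbFE/eqP->.
      by rewrite /= root_of0; case: eqP => _; rewrite subrr.
    by move: r1; rewrite B0 mxrank0.
  have [k /andP[wk ki]|one] := pickP (fun k => (w (k, 0) != (k, 0)) && (k != i)); last first.
    have w1 : w = 1%g.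
      apply: (W_moves_two (i0 := i)) => // k ki; apply/eqP.
      by have := one k; rewrite ki andbT => /negbFE.
    by rewrite w1 perm1 eqxx in wi.
  have wik : (w (i, 0)).1 = k by apply: swap; rewrite // eq_sym.
  have ik : ((i, 0) : pt).1 != (w (i, 0)).1 by rewrite wik eq_sym.
  suff -> : w = refl (i, 0) (w (i, 0)) by apply: mem_refl.
  have tW := refl_W ik.
  apply/eqP; rewrite eq_mulgV1 reflV //; apply/eqP.
  apply: (W_moves_two (i0 := k)); first by rewrite groupM.
  move=> j jk; have [->|ji] := eqVneq j i; first by rewrite permM refl_r.
  rewrite permM; have [->|wj] := eqVneq (w (j, 0)) (j, 0).
    by rewrite refl_out //= wik.
  have ij : (w (i, 0)).1 = j by apply: swap; rewrite // eq_sym.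
  by rewrite -ij wik eqxx in jk.
set i := x.1 in xy; set j := y.1 in xy.
have ij : ((i, 0 : C) : pt).1 != ((j, y.2 - x.2) : pt).1 by [].
have {}wE : w = refl (i, 0) (j, y.2 - x.2).
  rewrite wE -(refl_shift x.2 ij) /shift /= add0r subrK.
  by rewrite -!surjective_pairing.
set c := y.2 - x.2 in wE ij.
have wi : w (i, 0) = (j, c) by rewrite wE refl_l.
have wj : w (j, 0) = (i, - c).
  have -> : (j, 0) = shift (- c) (j, c) :> pt by rewrite /shift /= subrr.
  by rewrite ew wE refl_r // /shift /= add0r.
pose ci : 'cV[algC]_n := \col_k ((k == i)%:R - root_of (- c) * (k == j)%:R).
pose rj : 'rV[algC]_n := \row_l (root_of c * (l == j)%:R - (l == i)%:R).
have cc : root_of (- c) * root_of c = 1 by rewrite -root_ofD addNr root_of0.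
have BM : B = ci *m rj.
  apply/matrixP=> k l; rewrite BE !mxE big_ord1 !mxE.
  have [->|ki] := eqVneq k i.
    rewrite wi /= (negPf xy) mulr0 subr0 mul1r [j == l]eq_sym [i == l]eq_sym.
    by case: eqP => _; rewrite ?mulr1 ?mulr0.
  have [->|kj] := eqVneq k j.
    rewrite wj /= sub0r mulr1 mulrBr mulrA mulNr cc [i == l]eq_sym [j == l]eq_sym.
    by case: (l == i); case: (l == j) => /=; ring.
  rewrite wE refl_out //= root_of0 !mulr0 subrr mul0r.
  by case: eqP; rewrite subrr.
apply/eqP; rewrite eqn_leq BM mulmx_max_rank -BM lt0n mxrank_eq0 /=.
apply/eqP=> B0; have := congr1 (fun A : 'M[algC]_n => A i i) B0.
rewrite BE wi /= eqxx eq_sym (negPf xy) mxE sub0r => /eqP.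
by rewrite oppr_eq0 oner_eq0.
Qed.

Lemma words_mx_of k w : w \in (refls I C ^+ k)%g ->
  exists s, [/\ all (@is_reflection d n) s, size s = k & mprod s = mx_of w].
Proof.
elim: k w => [|k IH] w; first by rewrite expg0 => /set1gP->; exists [::]; rewrite mx_of1.
rewrite expgS => /mulsgP[t v tT vk ->]; have [s [sr sk sE]] := IH v vk.
exists (mx_of t :: s); split=> /=.
- by rewrite is_reflection_mx_of ?tT ?sr // refls_W.
- by rewrite sk.
by rewrite sE mx_ofM //; apply: words_equivariant vk.
Qed.

Lemma mx_of_words s : all (@is_reflection d n) s ->
  exists2 w, w \in (refls I C ^+ size s)%g & mprod s = mx_of w.
Proof.
elim: s => [_|A s IH /= /andP[rA /IH[w ws sE]]].
  by exists 1%g; rewrite ?mx_of1 // expg0 inE.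
have /in_W_mx_ofP[t tW At] : in_W d A by case/andP: rA.
exists (t * w)%g; last by rewrite sE At mx_ofM //; apply: words_equivariant ws.
by rewrite expgS mem_mulg // -is_reflection_mx_of // -At.
Qed.

Lemma abs_length_mx_of w : w \in W -> abs_length d (mx_of w) = len w.
Proof.
move=> wW; have ew := W_equivariant wW.
have lenP : refl_word_len d (mx_of w) (len w).
  split; first by apply: words_mx_of; apply: len_word.
  move=> s /mx_of_words[v vs ->] e; apply: len_min.
  by rewrite -(mx_of_inj (words_equivariant vs) ew e).
have := ClassicalEpsilon.epsilon_spec (inhabits 0%N) _ (ex_intro _ _ lenP); rewrite -/(abs_length _ _).
case=> [[s [sr ss sE]] smin]; case: lenP => [[s' [sr' ss' sE']] smin'].
by apply/eqP; rewrite eqn_leq -{1}ss' smin // -ss smin'.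
Qed.

Lemma invmx_mx_of w : w \in W -> invmx (mx_of w) = mx_of w^-1%g.
Proof.
move=> wW; have e : mx_of w *m mx_of w^-1%g = 1%:M.
  by rewrite -mx_ofM ?mulgV ?mx_of1 //; apply: W_equivariant; rewrite groupV.
have [wu _] := mulmx1_unit e.
by rewrite -[LHS]mulmx1 -e mulmxA mulVmx // mul1mx.
Qed.

Lemma abs_le_mx_of u v : u \in W -> v \in W -> abs_le d (mx_of u) (mx_of v) = le u v.
Proof.
move=> uW vW; have uvW : (u^-1 * v)%g \in W by rewrite groupM ?groupV.
rewrite /abs_le invmx_mx_of // -mx_ofM ?abs_length_mx_of //.
exact: W_equivariant.
Qed.

Lemma in_NC_mx_of g (A : 'M[algC]_n) : g \in W ->
  reflect (exists2 u, u \in NC g & A = mx_of u) (in_NC d (mx_of g) A).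
Proof.
move=> gW; apply: (iffP and3P) => [[/in_W_mx_ofP[u uW ->] _]|[u /NC_P[uW ug] ->]].
  by rewrite abs_le_mx_of // => ug; exists u => //; apply/NC_P.
split; first by apply/in_W_mx_ofP; exists u.
  by rewrite -mx_of1 abs_le_mx_of ?le1 ?group1.
by rewrite abs_le_mx_of.
Qed.

Lemma mpow_mx_of w k : w \in W -> mpow (mx_of w) k = mx_of (w ^+ k)%g.
Proof.
move=> wW; elim: k => [|k IH]; first by rewrite expg0 mx_of1.
rewrite /mpow iterS -/(mpow _ k) IH expgS mx_ofM //.
by apply: W_equivariant; apply: groupX.
Qed.

(** * The cycle structure of Coxeter elements *)

Section Coxeter.
Import Num.Theory.
Hypothesis n_gt1 : (1 < n)%N.

Lemma coxeter_number_ge : (n.-1 * d <= coxeter_number d n)%N.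
Proof.
apply: (@leq_bigmax_seq _ (degrees d n) xpredT id (n.-1 * d)%N) => //.
rewrite mem_rcons inE; apply/orP; right; apply/mapP; exists n.-1 => //.
by rewrite mem_iota; lia.
Qed.

Variable w : {perm pt}.
Hypothesis wW : w \in W.
Hypothesis w_order : has_order (mx_of w) (coxeter_number d n).
Variable vec : 'cV[algC]_n.
Local Notation zeta := (zeta_of (coxeter_number d n)).
Local Notation V i := (vec i 0).
Hypothesis w_eigen : mx_of w *m vec = zeta *: vec.
Hypothesis vec_regular : forall r, is_reflection d r -> r *m vec != vec.

Let ew : equivariant w. Proof. exact: W_equivariant. Qed.

Lemma eigen_entry u (y : algC) i : mx_of u *m vec = y *: vec ->
  root_of (u (i, 0)).2 * V (u (i, 0)).1 = y * V i.
Proof.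
move=> e; have := congr1 (fun A : 'cV[algC]_n => A i 0) e; rewrite !mxE => <-.
rewrite (bigD1 (u (i, 0)).1) //= mxE eqxx big1 ?addr0 // => j ju.
by rewrite mxE eq_sym (negPf ju) mul0r.
Qed.

Let eigen_pow k : mx_of (w ^+ k)%g *m vec = zeta ^+ k *: vec.
Proof.
elim: k => [|k IH]; first by rewrite expg0 mx_of1 mul1mx expr0 scale1r.
rewrite expgSr mx_ofM // -mulmxA w_eigen -scalemxAr IH scalerA exprS.
by [].
Qed.

(** The reflecting hyperplanes are [V i = root_of c * V j]; regularity keeps [vec] off all of
    them. *)
Let V_indep i j c : i != j -> root_of c * V j != V i.
Proof.
move=> ij; apply/eqP=> e; have xy : ((i, 0 : C) : pt).1 != ((j, c) : pt).1 by [].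
have rr : is_reflection d (mx_of (refl (i, 0) (j, c))).
  by rewrite is_reflection_mx_of ?mem_refl // refl_W.
case/eqP: (vec_regular rr); apply/matrixP=> k l; rewrite !mxE [l]ord1.
set r := refl _ _; rewrite (bigD1 (r (k, 0)).1) //= mxE eqxx big1 ?addr0 => [|m mr]; last first.
  by rewrite mxE eq_sym (negPf mr) mul0r.
rewrite /r; have [->|ki] := eqVneq k i; first by rewrite refl_l.
have [->|kj] := eqVneq k j; last by rewrite refl_out //= root_of0 mul1r.
have -> : (j, 0) = shift (- c) (j, c) :> pt by rewrite /shift /= subrr.
rewrite refl_equivariant refl_r //= add0r -e mulrA -root_ofD addNr root_of0.
by rewrite mul1r.
Qed.

Let U i := V i ^+ d.

Let U_inj : injective U.
Proof.
move=> i j Uij; apply/eqP/negPn/negP=> ij.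
have [Vj0|Vj0] := eqVneq (V j) 0.
  have : V i ^+ d == 0 by rewrite -/(U i) Uij /U Vj0 expr0n; case: d d_gt1.
  rewrite expf_eq0 => /andP[_ /eqP Vi0].
  by have := V_indep 0 ij; rewrite Vi0 Vj0 mulr0 eqxx.
have [|c ce] := @root_of_surj (V i / V j).
  by rewrite expr_div_n -/(U i) -/(U j) Uij divff // expf_neq0.
by have := V_indep c ij; rewrite -ce divfK // eqxx.
Qed.

Let U_pow k i : U ((w ^+ k)%g (i, 0)).1 = zeta ^+ (d * k) * U i.
Proof.
have := congr1 (fun x => x ^+ d) (eigen_entry i (eigen_pow k)).
by rewrite !exprMn root_of_expr mul1r -exprM mulnC.
Qed.

Let diagonal k : zeta ^+ (d * k) = 1 -> forall i, ((w ^+ k)%g (i, 0)).1 = i.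
Proof. by move=> zk i; apply: U_inj; rewrite U_pow zk mul1r. Qed.

Let order_min k : (0 < k)%N -> (w ^+ k)%g = 1%g -> (n.-1 * d <= k)%N.
Proof.
move=> k0 wk; rewrite leqNgt; apply/negP=> kh; have [_ [_ h]] := w_order.
have := h k; rewrite k0 (leq_trans kh coxeter_number_ge) => /(_ isT).
by rewrite mpow_mx_of // wk mx_of1 eqxx.
Qed.

(** [w ^+ k] is diagonal with [d]-th roots of unity, so [w ^+ (k * d)] is trivial, while the order
    of [w] is at least [n.-1 * d]. *)
Let diagonal_order k : (0 < k)%N -> zeta ^+ (d * k) = 1 -> (n.-1 <= k)%N.
Proof.
move=> k0 zk; have dg := diagonal zk.
have uW : (w ^+ k)%g \in W by apply: groupX.
have eu := W_equivariant uW.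
have upow i m : ((w ^+ k) ^+ m)%g (i, 0) = (i, ((w ^+ k)%g (i, 0)).2 *+ m).
  set c := ((w ^+ k)%g (i, 0)).2; have wki : (w ^+ k)%g (i, 0) = shift c (i, 0).
    by rewrite [LHS]surjective_pairing dg /shift /= add0r.
  elim: m => [|m IH]; first by rewrite expg0 perm1 mulr0n.
  have e : (i, c *+ m) = shift (c *+ m) (i, 0) :> pt by rewrite /shift /= add0r.
  by rewrite expgSr permM IH e eu wki shiftD /shift /= add0r mulrS.
have u1 : (w ^+ (k * d))%g = 1%g.
  rewrite expgM; apply: equivariant_ext; first by apply: W_equivariant; apply: groupX.
    exact: equivariant1.
  move=> i; exists (i, 0); rewrite // perm1 upow; congr (_, _).
  by apply: root_of_inj; rewrite root_of_mulrn root_of_expr root_of0.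
have := order_min _ u1; rewrite muln_gt0 k0 leq_pmul2r; [apply|]; lia.
Qed.

(** In the product of the eigenvector equations over [A] the coordinates cancel, because [w]
    permutes the lines of [A]. *)
Let stable_card (A : {set I}) : A != set0 -> {in A, forall i, V i != 0} ->
  (forall i, i \in A -> (w (i, 0)).1 \in A) ->
  (n.-1 <= #|A|)%N /\ \prod_(i in A) root_of (w (i, 0)).2 = zeta ^+ #|A|.
Proof.
move=> A0 VA stA; pose s i := (w (i, 0)).1.
have s_inj : injective s by move=> i j /eqP; rewrite /s equivariant_line // => /eqP.
have sA : [set s i | i in A] = A.
  apply/eqP; rewrite eqEcard card_imset // leqnn andbT.
  by apply/subsetP=> _ /imsetP[i iA ->]; apply: stA.
have pV : \prod_(i in A) V i != 0 by apply/prodf_neq0.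
have pE : \prod_(i in A) root_of (w (i, 0)).2 = zeta ^+ #|A|.
  apply: (mulIf pV).
  rewrite -{1}[in X in _ * X]sA big_imset /=; last by move=> i j _ _; apply: s_inj.
  rewrite -big_split /= (eq_bigr (fun i => zeta * V i)) => [|i _].
    by rewrite big_split /= prodr_const.
  exact: eigen_entry w_eigen.
split=> //; apply: diagonal_order; first by rewrite card_gt0.
rewrite mulnC exprM -pE -prodrXl big1 // => i _; exact: root_of_expr.
Qed.

Let full_weight : \prod_i root_of (w (i, 0)).2 = 1.
Proof. by have /mem_W[_ w0] := wW; rewrite -root_of_sum -/(weight w) w0 root_of0. Qed.

(* By regularity the numbers [V i ^+ d] are distinct and [w] multiplies them by
   [zeta ^+ d] along its cycles, so a [w]-stable set [A] of lines with [V i != 0] makes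
   [w ^+ (#|A| * d)] trivial; the order of [w] then forces [#|A| >= n - 1]. *)
Theorem coxeter_one_cycle : exists n0 (a : C), a != 0 /\ one_cycle n0 a (~: [set n0]) w.
Proof.
have cycle n0 (a : C) : w (n0, 0) = shift (- a) (n0, 0) ->
    (forall i, i != n0 -> V i != 0) -> one_cycle n0 a (~: [set n0]) w.
  move=> wn Vn; split=> //; first by rewrite !inE eqxx.
    by move=> i; rewrite !inE negbK => ->.
  move=> A AS A0 Ast; apply/eqP; rewrite eqEcard AS /= cardsC1 card_ord.
  apply: (stable_card A0 _ Ast).1 => i iA; apply: Vn.
  by have := subsetP AS i iA; rewrite !inE.
(* A zero coordinate is unique, so its line is stable under [w]; that line is the centre. *)
have [n0 /eqP V0|Vn0] := pickP (fun i => V i == 0).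
  have Vn i : i != n0 -> V i != 0.
    move=> ni; apply/eqP=> Vi; have := V_indep 0 ni.
    by rewrite V0 Vi mulr0 eqxx.
  have wn1 : (w (n0, 0)).1 = n0.
    apply/eqP/negPn/negP=> /Vn/eqP; apply; apply: (mulfI (root_of_neq0 (w (n0, 0)).2)).
    by rewrite (eigen_entry _ w_eigen) V0 !mulr0.
  have [c wn] := same_line (x := (n0, 0)) (y := w (n0, 0)) (esym wn1).
  exists n0, (- c); split; last by apply: cycle => //; rewrite opprK.
  (* Without a turn at [n0] the other entries have product 1, so [zeta ^+ n.-1 = 1] and [w ^+ n.-1]
     is trivial, too early for its order. *)
  rewrite oppr_eq0; apply/eqP=> c0; rewrite c0 shift0 in wn.
  have nS i : (i \in ~: [set n0]) = (i != n0) by rewrite !inE.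
  have S0 : ~: [set n0] != set0 by rewrite -card_gt0 cardsC1 card_ord; lia.
  have Sst i : i \in ~: [set n0] -> (w (i, 0)).1 \in ~: [set n0].
    by rewrite !nS -{2}wn1 equivariant_line.
  have [_ pS] := stable_card S0 (fun i h => Vn i (etrans (esym (nS i)) h)) Sst.
  have z1 : zeta ^+ n.-1 = 1.
    rewrite -[n in n.-1]card_ord -(cardsC1 n0) -pS -[RHS]full_weight [RHS](bigD1 n0) //=.
    by rewrite wn root_of0 mul1r; apply: eq_bigl => i; rewrite nS.
  have u1 : (w ^+ n.-1)%g = 1%g.
    have dg : forall i, ((w ^+ n.-1)%g (i, 0)).1 = i.
      by apply: diagonal; rewrite mulnC exprM z1 expr1n.
    apply: (W_moves_two (i0 := n0)); first exact: groupX.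
    move=> i ni; rewrite [LHS]surjective_pairing dg; congr (_, _).
    apply: root_of_inj; apply: (mulIf (Vn i ni)); rewrite root_of0.
    by rewrite -{2}(dg i) (eigen_entry _ (eigen_pow _)) z1.
  have n1 : (0 < n.-1)%N by lia.
  by have := order_min n1 u1; rewrite leqNgt ltn_Pmulr.
(* With no zero coordinate [w ^+ n] is trivial, which leaves only [d = n = 2] and [w = - 1], where
   either line can serve as centre. *)
have Vn i : V i != 0 by rewrite Vn0.
have T0 : [set: I] != set0 by rewrite -card_gt0 cardsT card_ord; lia.
have [_ pT] := stable_card T0 (fun i _ => Vn i) (fun i _ => in_setT _).
have zn : zeta ^+ n = 1.
  by rewrite -[n in _ ^+ n]card_ord -cardsT -pT -[RHS]full_weight; apply: eq_bigl => i; rewrite inE.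
have un : (w ^+ n)%g = 1%g.
  have dg : forall i, ((w ^+ n)%g (i, 0)).1 = i.
    by apply: diagonal; rewrite mulnC exprM zn expr1n.
  apply: equivariant_ext; first by apply: W_equivariant; apply: groupX.
    exact: equivariant1.
  move=> i; exists (i, 0); rewrite // perm1 [LHS]surjective_pairing dg; congr (_, _).
  apply: root_of_inj; apply: (mulIf (Vn i)); rewrite root_of0.
  by rewrite -{2}(dg i) (eigen_entry _ (eigen_pow _)) zn.
have nd : (n.-1 * d <= n)%N by apply: order_min un; lia.
have n2 : n = 2 by move: nd n_gt1 d_gt1; case: (n) => [|[|[|m]]] //; nia.
have d2 : d = 2 by move: nd; rewrite n2; lia.
have zE : zeta = -1.
  rewrite (_ : coxeter_number d n = 2); first by rewrite /zeta_of rootCK.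
  by rewrite /coxeter_number d2 n2 /degrees /= !big_cons big_nil.
have w1 i : (w (i, 0)).1 = i.
  rewrite -[w]expg1; apply: diagonal.
  by rewrite zE muln1 d2 sqrrN expr1n.
have n_gt0 : (0 < n)%N by lia.
pose n0 : I := Ordinal n_gt0.
have [c wn] := same_line (x := (n0, 0)) (y := w (n0, 0)) (esym (w1 n0)).
exists n0, (- c); split; last by apply: cycle => //; rewrite opprK.
rewrite oppr_eq0; apply/eqP=> c0.
have := eigen_entry n0 w_eigen; rewrite w1 wn c0 /= addr0 root_of0 mul1r zE mulN1r.
move/eqP; rewrite -addr_eq0 -mulr2n mulrn_eq0 /=; exact/negP/Vn.
Qed.

End Coxeter.
End MonomialMatrices.

(** * Transfer to the interval of matrices *)

Theorem theorem1p3 (d n : nat) (g : 'M[algC]_n) (s : seq 'M[algC]_n) :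
  (2 <= d)%N -> (2 <= n)%N -> is_coxeter d g ->
  (forall x, (x \in s) = in_NC d g x) ->
  let le := @NC_le d n s in
  let rk := @NC_rk d n s in
  let N := abs_length d g in
  has_SBD le rk N /\ has_SCD le rk N /\ strongly_sperner le rk N /\
  rank_symmetric rk N /\ rank_unimodal rk N /\ gamma_nonnegative rk N.
Proof.
move=> d2 n2 [g_W [g_ord [v [g_eig v_reg]]]] sE nc_le nc_rk N.
have [z zP] := C_prim_root_exists (ltnW d2).
have [w wW gE] := in_W_mx_ofP d2 zP g g_W; rewrite {g_W}gE in g_ord g_eig sE N *.
have [n0 [a [a0 cyc]]] := coxeter_one_cycle d2 zP n2 wW g_ord g_eig v_reg.
have tile := tile_NC a0 wW cyc wW (le_refl w).
have sP A : reflect (exists2 u, u \in NC w & A = mx_of z u) (A \in s).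
  by rewrite sE; apply: in_NC_mx_of.
have s1 : mx_of z (1%g : {perm 'I_n * 'Z_d}) \in s.
  by apply/sP; exists 1%g => //; apply/NC_P; rewrite group1 le1.
(* The identity is only the default value of [f], for [u] outside [NC w]. *)
pose f (u : {perm 'I_n * 'Z_d}) : seq_sub s := insubd (SeqSub s1) (mx_of z u).
have fE u : u \in NC w -> val (f u) = mx_of z u.
  by move=> uw; rewrite /f insubdK //; apply/sP; exists u.
have f_surj (x : seq_sub s) : exists2 u, u \in NC w & x = f u.
  have /sP[u uw xE] := valP x; exists u => //.
  by apply: val_inj; rewrite fE.
have NW u : u \in NC w -> u \in W 'I_n 'Z_d by case/NC_P.
have NE : N = len w by rewrite /N (abs_length_mx_of d2 zP).
have f_le : {in NC w &, forall u u', nc_le (f u) (f u') = le u u'}.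
  by move=> u u' uw uw'; rewrite /nc_le /NC_le !fE // (abs_le_mx_of d2 zP) ?NW.
have f_rk : {in NC w, forall u, nc_rk (f u) = (len u + 0)%N}.
  by move=> u uw; rewrite /nc_rk /NC_rk fE // (abs_length_mx_of d2 zP) ?NW ?addn0.
apply: consequences_of_tiling.
  move=> x y; have [u uw ->] := f_surj x; have [u' uw' ->] := f_surj y.
  rewrite f_le // !f_rk // !addn0 => uu' nuu'; rewrite ltnNge; apply: contra nuu' => h.
  by rewrite (le_len_eq (NW _ uw) (NW _ uw') uu' h).
have <- : f @: NC w = setT.
  by apply/setP=> x; rewrite inE; have [u uw ->] := f_surj x; rewrite imset_f.
rewrite NE -[len w]addn0 -[X in sym_boolean _ _ X]addn0.
apply: tiled_boolean_map f_le f_rk tile => u u' uw uw' ff.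
apply: (mx_of_inj d2 zP); try exact: W_equivariant (NW _ _).
by rewrite -!fE // ff.
Qed.
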